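(* Let $\Sigma$ be an $L$-$\mathcal C$ bicomodule for a pure right coring extension $(\mathcal D:L)$ of $(\mathcal C:A)$, let $T=\mathrm{End}^{\mathcal C}(\Sigma)$, and let $U,V:\mathcal M^{\mathcal C}\to\mathcal M^{\mathcal D}$ be the $k$-linear functors $U(M)=(M,\tau_M)$ and $V=\mathrm{Hom}^{\mathcal C}(\Sigma,-)\otimes_L\mathcal D$. There are $k$-linear isomorphisms $$\alpha_1:{}_L\mathrm{Hom}_L(\mathcal D,T)\to\mathrm{Nat}(V,V)^{op},\qquad \alpha_2:{}^{\mathcal C}\mathrm{End}^{\mathcal D}(\mathcal C)^{op}\to\mathrm{Nat}(U,U)^{op},$$ $$\alpha_3:{}_L\mathrm{Hom}^{\mathcal D}(\mathcal D,\Sigma)\to\mathrm{Nat}(V,U),\qquad \alpha_4:\widetilde Q\to\mathrm{Nat}(U,V).$$ Moreover, these maps establish an isomorphism between the Morita context $(\mathrm{Nat}(V,V)^{op},\mathrm{Nat}(U,U)^{op},\mathrm{Nat}(V,U),\mathrm{Nat}(U,V),\blacksquare,\square)$ and the Morita context $$\widetilde{\mathbb M}(\Sigma)=({}_L\mathrm{Hom}_L(\mathcal D,T),\ {}^{\mathcal C}\mathrm{End}^{\mathcal D}(\mathcal C)^{op},\ {}_L\mathrm{Hom}^{\mathcal D}(\mathcal D,\Sigma),\ \widetilde Q,\ \bullet,\ \lozenge),$$ whose algebra structures, bimodule structures and connecting homomorphisms are given by $$(vv')(d)=v(d_{(1)})v'(d_{(2)}),\quad (uu')(c)=u'(u(c)),$$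 $$(vp)(d)=v(d_{(1)})\big(p(d_{(2)})\big),\quad (pu)(d)=p(d)^{[0]}\epsilon_{\mathcal C}\big(u(p(d)^{[1]})\big),$$ $$(qv)(c)=q(c_{[0]})v(c_{[1]}),\quad (uq)(c)=q(u(c)),$$ $$(q\bullet p)(c)=c^{(1)}q({c^{(2)}}_{[0]})\big(p({c^{(2)}}_{[1]})\big)=q(c_{[0]})\big(p(c_{[1]})^{[0]}\big)p(c_{[1]})^{[1]},$$ $$(p\lozenge q)(d)=p(d)^{[0]}q\big(p(d)^{[1]}\big)(-),$$ for $v,v'\in{}_L\mathrm{Hom}_L(\mathcal D,T)$, $u,u'\in{}^{\mathcal C}\mathrm{End}^{\mathcal D}(\mathcal C)$, $p\in{}_L\mathrm{Hom}^{\mathcal D}(\mathcal D,\Sigma)$, $q\in\widetilde Q$, $d\in\mathcal D$ and $c\in\mathcal C$.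
   Context: Corings. Fix a commutative ring $k$; all algebras are associative unital $k$-algebras. For an algebra $A$, an $A$-coring is an $A$-bimodule $\mathcal C$ with $A$-bilinear coassociative coproduct $\Delta_{\mathcal C}:\mathcal C\to\mathcal C\otimes_A\mathcal C$, $c\mapsto c^{(1)}\otimes_A c^{(2)}$, and $A$-bilinear counit $\epsilon_{\mathcal C}:\mathcal C\to A$. A right $\mathcal C$-comodule is a right $A$-module $M$ with a right $A$-linear coassociative counital coaction $M\to M\otimes_A\mathcal C$, $m\mapsto m^{[0]}\otimes_A m^{[1]}$. $\mathcal M^{\mathcal C}$ is the category of right $\mathcal C$-comodules, with hom sets $\mathrm{Hom}^{\mathcal C}(-,-)$. Pure coring extensions. Let $\mathcal D$ be an $L$-coring; its coproduct and right coactions are written with lower indices, $d\mapsto d_{(1)}\otimes_L d_{(2)}$, $m\mapsto m_{[0]}\otimes_L m_{[1]}$. $(\mathcal D:L)$ is a right extension of $(\mathcal C:A)$ if $\mathcal C$ is a $\mathcal C$-$\mathcal D$ bicomodule with left regular coaction $\Delta_{\mathcal C}$ and some right $\mathcal D$-coaction $\tau_{\mathcal C}:c\mapsto c_{[0]}\otimes_L c_{[1]}$ (so the right $L$-action and $\tau_{\mathcal C}$ are left $A$-linear, and $\Delta_{\mathcal C}$ is right $\mathcal D$-colinear, $\mathcal C\otimes_A\mathcal C$ having coaction $\mathcal C\otimes_A\tau_{\mathcal C}$). Every right $\mathcal C$-comodule $M$ is a right $L$-module via $ml=m^{[0]}\epsilon_{\mathcal C}(m^{[1]}l)$. The extension is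 pure if for every right $\mathcal C$-comodule $(M,\varrho)$ the equalizer $M\xrightarrow{\varrho}M\otimes_A\mathcal C\rightrightarrows M\otimes_A\mathcal C\otimes_A\mathcal C$ of $\varrho\otimes_A\mathcal C$ and $M\otimes_A\Delta_{\mathcal C}$ in $\mathcal M_L$ is preserved by $-\otimes_L\mathcal D\otimes_L\mathcal D$. In this case every right $\mathcal C$-comodule $M$ is a right $\mathcal D$-comodule via $\tau_M(m)=m^{[0]}\epsilon_{\mathcal C}({m^{[1]}}_{[0]})\otimes_L{m^{[1]}}_{[1]}$, and $\mathcal C$-colinear maps are $\mathcal D$-colinear; this gives the functor $U$ (identity on morphisms). Bicomodules. An $L$-$\mathcal C$ bicomodule is a left $L$-module and right $\mathcal C$-comodule $\Sigma$ (an $L$-$A$ bimodule) with left $L$-linear $\mathcal C$-coaction. $T=\mathrm{End}^{\mathcal C}(\Sigma)$ is an algebra under composition and an $L$-ring via $l\mapsto(x\mapsto lx)$. $\mathrm{Hom}^{\mathcal C}(\Sigma,M)$ is a right $L$-module via $(\varphi l)(x)=\varphi(lx)$, and $V(M)=\mathrm{Hom}^{\mathcal C}(\Sigma,M)\otimes_L\mathcal D$ has coaction $\mathrm{Hom}^{\mathcal C}(\Sigma,M)\otimes_L\Delta_{\mathcal D}$. $\Sigma^*=\mathrm{Hom}_A(\Sigma,A)$ is an $A$-$L$ bimodule via $(a\xi l)(x)=a\xi(lx)$, and $$\widetilde Q=\{q\in{}_A\mathrm{Hom}_L(\mathcal C,\Sigma^* )\mid c^{(1)}q(c^{(2)})(x)=q(c)(x^{[0]})x^{[1]}\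 \ \forall x\in\Sigma,\,c\in\mathcal C\}.$$ ${}_L\mathrm{Hom}_L$ means $L$-bimodule maps, ${}_L\mathrm{Hom}^{\mathcal D}$ left $L$-linear right $\mathcal D$-colinear maps, ${}^{\mathcal C}\mathrm{End}^{\mathcal D}(\mathcal C)$ left $\mathcal C$-colinear right $\mathcal D$-colinear endomorphisms. The Morita context of natural transformations. $\mathrm{Nat}$ denotes natural transformations. In the first Morita context all algebra and bimodule structures are given by the opposite composition of natural transformations: $\Phi\cdot\Phi'=\Phi'\circ\Phi$, $\Phi\cdot\Theta\cdot\Xi=\Xi\circ\Theta\circ\Phi$ for $\Phi\in\mathrm{Nat}(V,V)$, $\Theta\in\mathrm{Nat}(V,U)$, $\Xi\in\mathrm{Nat}(U,U)$, and $\Xi\cdot\Omega\cdot\Phi=\Phi\circ\Omega\circ\Xi$ for $\Omega\in\mathrm{Nat}(U,V)$; the connecting maps are $\blacksquare:\Omega\otimes\Theta\mapsto\Theta\circ\Omega\in\mathrm{Nat}(U,U)^{op}$ and $\square:\Theta\otimes\Omega\mapsto\Omega\circ\Theta\in\mathrm{Nat}(V,V)^{op}$. A Morita context $(R,S,P,Q,\bullet,\lozenge)$ consists of algebras $R,S$, an $R$-$S$ bimodule $P$, an $S$-$R$ bimodule $Q$, and bimodule maps $\bullet:Q\otimes_RP\to S$, $\lozenge:P\otimes_SQ\to R$ with the usual associativity conditions. An isomorphism of Morita contexts is a quadruple of isomorphisms (two algebra isomorphisms, two compatible bimodule isomorphisms) compatible with the connecting maps. *)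

(* Defs.v *)
From HB Require Import structures.
From mathcomp Require Import all_boot all_algebra.
From mathcomp Require Import boolp.

Set Implicit Arguments.
Unset Strict Implicit.
Unset Printing Implicit Defensive.

Import GRing.Theory.
Local Open Scope ring_scope.

Section LinearLemmas.
Variable k : comPzRingType.
Variables U V W : lmodType k.

Lemma lin0 (f : U -> V) : linear f -> f 0 = 0.
Proof. by move=> lf; rewrite -[X in f X](subrr 0) -scaleN1r addrC lf scaleN1r addNr. Qed.

Lemma linD (f : U -> V) : linear f -> forall x y, f (x + y) = f x + f y.
Proof. by move=> lf x y; rewrite -[x]scale1r lf !scale1r. Qed.

Lemma linZ (f : U -> V) : linear f -> forall c x, f (c *: x) = c *: f x.
Proof. by move=> lf c x; rewrite -[c *: x]addr0 lf (lin0 lf) addr0. Qed.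

Lemma linB (f : U -> V) : linear f -> forall x y, f (x - y) = f x - f y.
Proof. by move=> lf x y; rewrite linD // -!scaleN1r linZ. Qed.

Lemma lin_sum (f : U -> V) I (s : seq I) (F : I -> U) :
  linear f -> f (\sum_(i <- s) F i) = \sum_(i <- s) f (F i).
Proof. by move=> lf; apply: big_morph; [exact: linD | exact: lin0]. Qed.

Lemma lin_id : linear (fun x : U => x).
Proof. by []. Qed.

Lemma lin_comp (f : U -> V) (g : V -> W) :
  linear f -> linear g -> linear (fun x => g (f x)).
Proof. by move=> lf lg c x y; rewrite lf lg. Qed.

Lemma lin_cstZ (c : k) (f : U -> V) : linear f -> linear (fun x => c *: f x).
Proof.
by move=> lf b x y; rewrite lf scalerDr !scalerA mulrC.
Qed.

Lemma lin_add (f g : U -> V) :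
  linear f -> linear g -> linear (fun x => f x + g x).
Proof. by move=> lf lg c x y; rewrite lf lg scalerDr addrACA. Qed.

End LinearLemmas.

(* Algebras.  MathComp's [algType k] excludes the zero algebra, whereas the
   endomorphism algebra of a comodule, or an algebra of natural
   transformations, may well be zero; hence the following structure on a
   [lmodType]. *)

Record kalgebra_on (k : comPzRingType) (V : lmodType k) := KAlgebraOn {
  kmul : V -> V -> V;
  kone : V;
  kmulA : forall x y z, kmul x (kmul y z) = kmul (kmul x y) z;
  kmul1l : forall x, kmul kone x = x;
  kmul1r : forall x, kmul x kone = x;
  kmul_linl : forall y, linear (kmul^~ y);
  kmul_linr : forall x, linear (kmul x) }.

Record kalgebra (k : comPzRingType) := KAlgebra {
  ka_mod :> lmodType k;
  ka_str :> kalgebra_on ka_mod }.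

Definition algType_kalgebra (k : comPzRingType) (A : algType k) : kalgebra k :=
  @KAlgebra k A (@KAlgebraOn k A *%R 1 (@mulrA A) (@mul1r A) (@mulr1 A)
    (fun y c u v => etrans (mulrDl _ _ _) (congr1 (+%R^~ _) (esym (scalerAl c u y))))
    (fun x c u v => etrans (mulrDr _ _ _) (congr1 (+%R^~ _) (esym (scalerAr c x u))))).

(* Modules over a k-algebra A.  One carrier often bears several commuting (or
   even non-commuting) actions, so these are explicit records over an
   underlying k-module, not canonical structures.  Bilinearity over k of the
   actions makes all bimodules k-symmetric. *)

Record lmodule (k : comPzRingType) (A : kalgebra k) (V : lmodType k) := LModule {
  lact : A -> V -> V;
  lact_linl : forall v, linear (lact^~ v);
  lact_linr : forall a, linear (lact a);
  lactA : forall a b v, lact a (lact b v) = lact (kmul A a b) v;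
  lact1 : forall v, lact (kone A) v = v }.

Record rmodule (k : comPzRingType) (A : kalgebra k) (V : lmodType k) := RModule {
  ract : V -> A -> V;
  ract_linl : forall a, linear (ract^~ a);
  ract_linr : forall v, linear (ract v);
  ractA : forall v a b, ract (ract v a) b = ract v (kmul A a b);
  ract1 : forall v, ract v (kone A) = v }.

Record bimod (k : comPzRingType) (B A : kalgebra k) (V : lmodType k) := BiMod {
  bm_l :> lmodule B V;
  bm_r :> rmodule A V;
  bm_comm : forall b v a, ract bm_r (lact bm_l b v) a = lact bm_l b (ract bm_r v a) }.

Section Homs.
Variables (k : comPzRingType) (A B : kalgebra k) (V W : lmodType k).

Definition lhom (l : lmodule A V) (l' : lmodule A W) (f : V -> W) :=
  linear f /\ forall a v, f (lact l a v) = lact l' a (f v).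

Definition rhom (r : rmodule A V) (r' : rmodule A W) (f : V -> W) :=
  linear f /\ forall v a, f (ract r v a) = ract r' (f v) a.

Definition bihom (b : bimod A B V) (b' : bimod A B W) (f : V -> W) :=
  [/\ linear f, forall a v, f (lact b a v) = lact b' a (f v)
    & forall v a, f (ract b v a) = ract b' (f v) a].

End Homs.

Lemma bihom_l (k : comPzRingType) (A B : kalgebra k) (V W : lmodType k)
  (b : bimod A B V) (b' : bimod A B W) f : bihom b b' f -> lhom b b' f.
Proof. by case. Qed.
Lemma bihom_r (k : comPzRingType) (A B : kalgebra k) (V W : lmodType k)
  (b : bimod A B V) (b' : bimod A B W) f : bihom b b' f -> rhom b b' f.
Proof. by case. Qed.
Lemma lhom_id (k : comPzRingType) (A : kalgebra k) (V : lmodType k)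
  (l : lmodule A V) : lhom l l (fun x => x).
Proof. by split. Qed.
Lemma rhom_id (k : comPzRingType) (A : kalgebra k) (V : lmodType k)
  (l : rmodule A V) : rhom l l (fun x => x).
Proof. by split. Qed.

Definition reg_bm (k : comPzRingType) (A : kalgebra k) : bimod A A A :=
  @BiMod k A A A
    (@LModule k A A (kmul A) (@kmul_linl _ _ A) (@kmul_linr _ _ A)
       (@kmulA _ _ A) (@kmul1l _ _ A))
    (@RModule k A A (kmul A) (@kmul_linl _ _ A) (@kmul_linr _ _ A)
       (fun v a b => esym (kmulA _ v a b)) (@kmul1r _ _ A))
    (fun b v a => esym (kmulA _ b v a)).

(* The tensor product V ⊗_A W, by generators and relations: formal sums of
   pairs modulo the congruence [tens_eq], a class being represented by its
   canonical element.  Stability of [tens_eq] under scalars is a consequence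
   (lemma [tens_eq_scl]); the scalar c acts by c(v ⊗ w) = (cv) ⊗ w. *)

Section Tensor.
Variables (k : comPzRingType) (A : kalgebra k) (V W : lmodType k).
Variables (r : rmodule A V) (l : lmodule A W).
Implicit Types s : seq (V * W).

Inductive tens_eq : seq (V * W) -> seq (V * W) -> Prop :=
| te_refl s : tens_eq s s
| te_sym s t : tens_eq s t -> tens_eq t s
| te_trans s t u : tens_eq s t -> tens_eq t u -> tens_eq s u
| te_cat s s' t t' : tens_eq s s' -> tens_eq t t' -> tens_eq (s ++ t) (s' ++ t')
| te_comm s t : tens_eq (s ++ t) (t ++ s)
| te_zero w : tens_eq [:: (0, w)] [::]
| te_Dl v v' w : tens_eq [:: (v + v', w)] [:: (v, w); (v', w)]
| te_Dr v w w' : tens_eq [:: (v, w + w')] [:: (v, w); (v, w')]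
| te_act v a w : tens_eq [:: (ract r v a, w)] [:: (v, lact l a w)].

Definition fs_scl (c : k) s := [seq (c *: p.1, p.2) | p <- s].

Lemma tens_eq_scl c s s' : tens_eq s s' -> tens_eq (fs_scl c s) (fs_scl c s').
Proof.
elim=> [t|t t' _ IH|t t' u _ IH1 _ IH2|s1 s2 t1 t2 _ IH1 _ IH2|t t'|w|v v' w|v w w'|v a w].
- exact: te_refl.
- exact: te_sym.
- exact: te_trans IH1 IH2.
- by rewrite /fs_scl !map_cat; exact: te_cat.
- by rewrite /fs_scl !map_cat; exact: te_comm.
- by rewrite /= scaler0; exact: te_zero.
- by rewrite /= scalerDr; exact: te_Dl.
- exact: te_Dr.
- by rewrite /= -(linZ (ract_linl r a)); exact: te_act.
Qed.

Definition tens_canon s := choose (fun s' => `[< tens_eq s s' >]) s.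

Lemma tens_canon_eq s : tens_eq s (tens_canon s).
Proof.
apply/asboolP; rewrite /tens_canon.
by apply: (@chooseP _ (fun s' => `[< tens_eq s s' >])); apply/asboolP/te_refl.
Qed.

Lemma tens_canonP s s' : tens_eq s s' -> tens_canon s = tens_canon s'.
Proof.
move=> e; rewrite /tens_canon.
have E : (fun t => `[< tens_eq s t >]) =1 (fun t => `[< tens_eq s' t >]).
  by move=> t; apply: asbool_equiv_eq; split=> h;
    [exact: te_trans (te_sym e) h | exact: te_trans e h].
rewrite (eq_choose E); apply: choose_id; apply/asboolP; last exact: te_refl.
exact: te_sym.
Qed.

Definition tens : Type := {s : seq (V * W) | tens_canon s = s}.

HB.instance Definition _ := gen_eqMixin tens.
HB.instance Definition _ := gen_choiceMixin tens.

Definition tens_mk s : tens :=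
  exist _ (tens_canon s) (esym (tens_canonP (tens_canon_eq s))).
Definition tens_rep (t : tens) : seq (V * W) := sval t.

Lemma tens_mkE s s' : tens_eq s s' -> tens_mk s = tens_mk s'.
Proof. by move=> e; apply: eq_exist; exact: tens_canonP. Qed.
Lemma tens_repK t : tens_mk (tens_rep t) = t.
Proof. by case: t => s e; apply: eq_exist. Qed.
Lemma tens_mkK s : tens_eq (tens_rep (tens_mk s)) s.
Proof. exact: te_sym (tens_canon_eq s). Qed.

Definition tens_zero := tens_mk [::].
Definition tens_add t u := tens_mk (tens_rep t ++ tens_rep u).
Definition tens_scl c t := tens_mk (fs_scl c (tens_rep t)).

Lemma tens_mk_cat s s' : tens_mk (s ++ s') = tens_add (tens_mk s) (tens_mk s').
Proof. by apply/tens_mkE/te_cat; apply/te_sym/tens_mkK. Qed.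
Lemma tens_mk_scl c s : tens_mk (fs_scl c s) = tens_scl c (tens_mk s).
Proof. by apply/tens_mkE/tens_eq_scl/te_sym/tens_mkK. Qed.

Lemma tens_addA : associative tens_add.
Proof.
move=> t u v; rewrite -[t]tens_repK -[u]tens_repK -[v]tens_repK.
by rewrite -!tens_mk_cat catA.
Qed.
Lemma tens_addC : commutative tens_add.
Proof. by move=> t u; apply/tens_mkE/te_comm. Qed.
Lemma tens_add0 : left_id tens_zero tens_add.
Proof. by move=> t; rewrite -[t]tens_repK -tens_mk_cat. Qed.

Let cons_cat p s : tens_mk (p :: s) = tens_add (tens_mk [:: p]) (tens_mk s).
Proof. by rewrite -tens_mk_cat. Qed.

Lemma tens_sclDl_subproof c d t :
  tens_scl (c + d) t = tens_add (tens_scl c t) (tens_scl d t).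
Proof.
rewrite -[t]tens_repK -!tens_mk_scl.
elim: (tens_rep t) => [|[v w] s IH]; first by rewrite /= tens_add0.
rewrite /= [LHS]cons_cat [X in _ = tens_add X _]cons_cat.
rewrite [X in _ = tens_add _ X]cons_cat IH scalerDl (tens_mkE (te_Dl _ _ _)).
rewrite [X in tens_add X _ = _]cons_cat -!tens_addA; congr tens_add.
by rewrite !tens_addA; congr tens_add; rewrite tens_addC.
Qed.

Lemma tens_scl1_subproof : left_id 1 tens_scl.
Proof.
move=> t; rewrite -[RHS]tens_repK /tens_scl; congr tens_mk.
by elim: (tens_rep t) => [//|[v w] s IH] /=; rewrite scale1r IH.
Qed.

Lemma tens_scl0_subproof t : tens_scl 0 t = tens_zero.
Proof.
rewrite -[t]tens_repK -!tens_mk_scl.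
elim: (tens_rep t) => [//|[v w] s IH] /=.
by rewrite cons_cat IH scale0r (tens_mkE (te_zero _)) tens_add0.
Qed.

Lemma tens_addN : left_inverse tens_zero (tens_scl (-1)) tens_add.
Proof.
move=> t; rewrite -[X in tens_add _ X]tens_scl1_subproof.
by rewrite -tens_sclDl_subproof addNr tens_scl0_subproof.
Qed.

HB.instance Definition _ :=
  GRing.isZmodule.Build tens tens_addA tens_addC tens_add0 tens_addN.

Lemma tens_sclA a b t : tens_scl a (tens_scl b t) = tens_scl (a * b) t.
Proof.
rewrite -[t]tens_repK -!tens_mk_scl /fs_scl -map_comp; congr tens_mk.
by apply: eq_map => -[v w] /=; rewrite scalerA.
Qed.
Lemma tens_sclDr : right_distributive tens_scl +%R.
Proof.
move=> c t u; rewrite -[t]tens_repK -[u]tens_repK.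
rewrite -[_ + _ in LHS]tens_mk_cat -!tens_mk_scl /fs_scl map_cat.
exact: tens_mk_cat.
Qed.

HB.instance Definition _ := GRing.Zmodule_isLmodule.Build k tens
  tens_sclA tens_scl1_subproof tens_sclDr (fun t c d => tens_sclDl_subproof c d t).

Definition tpure (v : V) (w : W) : tens := tens_mk [:: (v, w)].

(* [tsum t f] is Σ f(v_i, w_i) for a representative Σ v_i ⊗ w_i of t; it is
   the value at t of the map induced by f when f is balanced (lemmas [tsumE]
   and [tsum_lin]). *)
Definition tsum (t : tens) (Z : nmodType) (f : V -> W -> Z) : Z :=
  \sum_(p <- tens_rep t) f p.1 p.2.

Record balanced (Z : lmodType k) (f : V -> W -> Z) : Prop := Balanced {
  bal_l : forall w, linear (f^~ w);
  bal_r : forall v, linear (f v);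
  bal_m : forall v a w, f (ract r v a) w = f v (lact l a w) }.

Lemma tsum_eq (Z : lmodType k) (f : V -> W -> Z) s s' : balanced f ->
  tens_eq s s' -> \sum_(p <- s) f p.1 p.2 = \sum_(p <- s') f p.1 p.2.
Proof.
move=> bf; elim=> {s s'} [//|t t' _ ->//|t t' u _ -> _ -> //|s1 s2 t1 t2 _ IH1 _ IH2|t t'|w|v v' w|v w w'|v a w].
- by rewrite !big_cat /= IH1 IH2.
- by rewrite !big_cat /= addrC.
- by rewrite big_seq1 big_nil; exact: (lin0 (bal_l bf w)).
- by rewrite big_seq1 big_cons big_seq1; exact: (linD (bal_l bf w)).
- by rewrite big_seq1 big_cons big_seq1; exact: (linD (bal_r bf v)).
- by rewrite !big_seq1; exact: (bal_m bf).
Qed.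

Lemma tsum_mk (Z : lmodType k) (f : V -> W -> Z) s : balanced f ->
  tsum (tens_mk s) f = \sum_(p <- s) f p.1 p.2.
Proof. by move=> bf; apply: (tsum_eq bf); exact: tens_mkK. Qed.

Lemma tsumE (Z : lmodType k) (f : V -> W -> Z) v w : balanced f ->
  tsum (tpure v w) f = f v w.
Proof. by move=> bf; rewrite tsum_mk // big_seq1. Qed.

Lemma tsum_lin (Z : lmodType k) (f : V -> W -> Z) : balanced f ->
  linear (fun t => tsum t f).
Proof.
move=> bf c t u; rewrite -[t]tens_repK -[u]tens_repK.
rewrite -[c *: _]tens_mk_scl -[_ + _]tens_mk_cat !tsum_mk // big_cat /=.
congr (_ + _); rewrite big_map scaler_sumr; apply: eq_bigr => -[v w] _ /=.
exact: (linZ (bal_l bf w)).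
Qed.

Lemma tsum_ext (Z : nmodType) (f g : V -> W -> Z) t :
  (forall v w, f v w = g v w) -> tsum t f = tsum t g.
Proof. by move=> e; apply: eq_bigr => p _; exact: e. Qed.

Lemma tens_repE t : t = \sum_(p <- tens_rep t) tpure p.1 p.2.
Proof.
rewrite -[LHS]tens_repK; elim: (tens_rep t) => [|p s IH]; first by rewrite big_nil.
by rewrite big_cons -IH [LHS]cons_cat; case: p.
Qed.

Lemma tens_ext (Z : lmodType k) (F G : tens -> Z) : linear F -> linear G ->
  (forall v w, F (tpure v w) = G (tpure v w)) -> forall t, F t = G t.
Proof.
move=> lF lG e t; rewrite (tens_repE t) !lin_sum //.
by apply: eq_bigr => p _; exact: e.
Qed.

Lemma tpure_bal : balanced tpure.
Proof.
split.
- move=> w c v v'; rewrite [LHS](tens_mkE (te_Dl _ _ _)) cons_cat; congr (_ + _).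
  exact: (tens_mk_scl c [:: (v, w)]).
- move=> v c w w'; rewrite [LHS](tens_mkE (te_Dr _ _ _)) cons_cat; congr (_ + _).
  rewrite -[RHS](tens_mk_scl c [:: (v, w)]) /=; apply: tens_mkE.
  rewrite -[in X in tens_eq X _](lact1 l w) -(linZ (lact_linl l w)).
  apply: te_trans (te_sym (te_act _ _ _)) _.
  by rewrite (linZ (ract_linr r v)) ract1; exact: te_refl.
- by move=> v a w; apply/tens_mkE/te_act.
Qed.

End Tensor.

Notation "v ⊗ w" := (tpure _ _ v w) (at level 40, left associativity).
Notation "\swe_ ( x , y <- t ) E" := (tsum t (fun x y => E))
  (at level 36, E at level 36, x binder, y binder, t at level 36).

Lemma tsum_lin2 (k : comPzRingType) (A : kalgebra k) (V W : lmodType k)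
    (r : rmodule A V) (l : lmodule A W) (X Z : lmodType k)
    (F : X -> V -> W -> Z) (t : tens r l) :
  (forall v w, linear (fun x => F x v w)) -> linear (fun x => tsum t (F x)).
Proof.
move=> lF c x y; rewrite /tsum scaler_sumr -big_split /=.
by apply: eq_bigr => p _; exact: lF.
Qed.

Section Tmap.
Variables (k : comPzRingType) (A : kalgebra k) (V W V' W' : lmodType k).
Variables (r : rmodule A V) (l : lmodule A W) (r' : rmodule A V') (l' : lmodule A W').

Definition tmap (f : V -> V') (g : W -> W') (t : tens r l) : tens r' l' :=
  \swe_(v, w <- t) (f v ⊗ g w).

Variables (f : V -> V') (g : W -> W').
Hypotheses (hf : rhom r r' f) (hg : lhom l l' g).

Lemma tmap_bal : balanced r l (fun v w => f v ⊗ g w : tens r' l').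
Proof.
case: hf hg => lf fA [lg gA]; split.
- by move=> w; exact: lin_comp lf (bal_l (tpure_bal r' l') (g w)).
- by move=> v; exact: lin_comp lg (bal_r (tpure_bal r' l') (f v)).
- by move=> v a w; rewrite fA gA (bal_m (tpure_bal r' l')).
Qed.

Lemma tmapE v w : tmap f g (v ⊗ w) = f v ⊗ g w.
Proof. exact: tsumE tmap_bal. Qed.

Lemma tmap_lin : linear (tmap f g).
Proof. exact: tsum_lin tmap_bal. Qed.

End Tmap.

Arguments tmap {k A V W V' W' r l r' l'} f g t.

Section TensModules.
Variables (k : comPzRingType) (A B C : kalgebra k) (V W : lmodType k).

Lemma lact_rhom (b : bimod B A V) x : rhom b b (lact b x).
Proof. by split; [exact: lact_linr | move=> v a; rewrite bm_comm]. Qed.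

Lemma ract_lhom (b : bimod A C W) x : lhom b b ((ract b)^~ x).
Proof. by split; [exact: ract_linl | move=> v a; rewrite bm_comm]. Qed.

Section Left.
Variables (b : bimod B A V) (l : lmodule A W).

Definition tens_lact (x : B) (t : tens b l) : tens b l :=
  tmap (lact b x) (fun w => w) t.

Lemma tens_lactE x v w : tens_lact x (v ⊗ w) = lact b x v ⊗ w.
Proof. exact: (tmapE (lact_rhom b x) (lhom_id l)). Qed.

Lemma tens_lact_linr x : linear (tens_lact x).
Proof. exact: (tmap_lin (lact_rhom b x) (lhom_id l)). Qed.

Lemma tens_lact_linl t : linear (tens_lact^~ t).
Proof.
apply: tsum_lin2 => v w.
exact: lin_comp (lact_linl b v) (bal_l (tpure_bal b l) w).
Qed.

Lemma tens_lactA x y t :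
  tens_lact x (tens_lact y t) = tens_lact (kmul B x y) t.
Proof.
move: t; apply: tens_ext; [|exact: tens_lact_linr|].
  exact: lin_comp (tens_lact_linr y) (tens_lact_linr x).
by move=> v w; rewrite !tens_lactE lactA.
Qed.

Lemma tens_lact1 t : tens_lact (kone B) t = t.
Proof.
move: t; apply: tens_ext; [exact: tens_lact_linr|exact: lin_id|].
by move=> v w; rewrite !tens_lactE lact1.
Qed.

Definition tens_l : lmodule B (tens b l) :=
  LModule tens_lact_linl tens_lact_linr tens_lactA tens_lact1.

End Left.

Section Right.
Variables (r : rmodule A V) (b : bimod A C W).

Definition tens_ract (t : tens r b) (x : C) : tens r b :=
  tmap (fun v => v) ((ract b)^~ x) t.

Lemma tens_ractE x v w : tens_ract (v ⊗ w) x = v ⊗ ract b w x.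
Proof. exact: (tmapE (rhom_id r) (ract_lhom b x)). Qed.

Lemma tens_ract_linl x : linear (tens_ract^~ x).
Proof. exact: (tmap_lin (rhom_id r) (ract_lhom b x)). Qed.

Lemma tens_ract_linr t : linear (tens_ract t).
Proof.
apply: (tsum_lin2 (F := fun x v w => v ⊗ ract b w x)) => v w.
exact: lin_comp (ract_linr b w) (bal_r (tpure_bal r b) v).
Qed.

Lemma tens_ractA t x y :
  tens_ract (tens_ract t x) y = tens_ract t (kmul C x y).
Proof.
move: t; apply: tens_ext; [|exact: tens_ract_linl|].
  exact: lin_comp (tens_ract_linl x) (tens_ract_linl y).
by move=> v w; rewrite !tens_ractE ractA.
Qed.

Lemma tens_ract1 t : tens_ract t (kone C) = t.
Proof.
move: t; apply: tens_ext; [exact: tens_ract_linl|exact: lin_id|].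
by move=> v w; rewrite !tens_ractE ract1.
Qed.

Definition tens_r : rmodule C (tens r b) :=
  RModule tens_ract_linl tens_ract_linr tens_ractA tens_ract1.

End Right.

Section Both.
Variables (b : bimod B A V) (c : bimod A C W).

Lemma tens_comm x t y :
  ract (tens_r b c) (lact (tens_l b c) x t) y =
  lact (tens_l b c) x (ract (tens_r b c) t y).
Proof.
move: t; apply: tens_ext.
- exact: lin_comp (lact_linr (tens_l b c) x) (ract_linl (tens_r b c) y).
- exact: lin_comp (ract_linl (tens_r b c) y) (lact_linr (tens_l b c) x).
- by move=> v w /=; rewrite tens_lactE !tens_ractE tens_lactE.
Qed.

Definition tens_b : bimod B C (tens b c) := BiMod tens_comm.

End Both.
End TensModules.

Section Tassoc.
Variables (k : comPzRingType) (A B : kalgebra k) (U V W : lmodType k).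
Variables (r : rmodule A U) (b : bimod A B V) (l : lmodule B W).

Definition tassoc (t : tens (tens_r r b) l) : tens r (tens_l b l) :=
  \swe_(x, w <- t) (\swe_(u, v <- x) (u ⊗ (v ⊗ w))).

Definition tassoci (t : tens r (tens_l b l)) : tens (tens_r r b) l :=
  \swe_(u, y <- t) (\swe_(v, w <- y) ((u ⊗ v) ⊗ w)).

Lemma tassoc_bal1 (w : W) : balanced r b (fun u v => u ⊗ (v ⊗ w) : tens r (tens_l b l)).
Proof.
split.
- by move=> v; exact: (bal_l (tpure_bal r (tens_l b l)) (v ⊗ w)).
- move=> u; exact: lin_comp (bal_l (tpure_bal b l) w) (bal_r (tpure_bal r (tens_l b l)) u).
- by move=> u a v; rewrite (bal_m (tpure_bal _ _)) /= tens_lactE.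
Qed.

Lemma tassoc_bal : balanced (tens_r r b) l
  (fun x w => \swe_(u, v <- x) (u ⊗ (v ⊗ w)) : tens r (tens_l b l)).
Proof.
split.
- by move=> w; exact: tsum_lin (tassoc_bal1 w).
- move=> x; apply: (tsum_lin2 (F := fun w u v => u ⊗ (v ⊗ w))) => u v.
  exact: lin_comp (bal_r (tpure_bal b l) v) (bal_r (tpure_bal r (tens_l b l)) u).
- move=> x a w; move: x; apply: tens_ext.
  + exact: lin_comp (ract_linl (tens_r r b) a) (tsum_lin (tassoc_bal1 w)).
  + exact: tsum_lin (tassoc_bal1 _).
  + move=> u v; rewrite [ract _ _ _]tens_ractE !(tsumE _ _ (tassoc_bal1 _)).
    by rewrite (bal_m (tpure_bal b l)).
Qed.

Lemma tassocE u v w : tassoc ((u ⊗ v) ⊗ w) = u ⊗ (v ⊗ w).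
Proof. by rewrite /tassoc (tsumE _ _ tassoc_bal) (tsumE _ _ (tassoc_bal1 w)). Qed.

Lemma tassoc_lin : linear tassoc.
Proof. exact: tsum_lin tassoc_bal. Qed.

Lemma tassoci_bal1 (u : U) : balanced b l (fun v w => (u ⊗ v) ⊗ w : tens (tens_r r b) l).
Proof.
split.
- move=> w; exact: lin_comp (bal_r (tpure_bal r b) u) (bal_l (tpure_bal (tens_r r b) l) w).
- by move=> v; exact: (bal_r (tpure_bal (tens_r r b) l) (u ⊗ v)).
- move=> v a w; rewrite -(bal_m (tpure_bal (tens_r r b) l)).
  by rewrite [ract (tens_r _ _) _ _]tens_ractE.
Qed.

Lemma tassoci_bal : balanced r (tens_l b l)
  (fun u y => \swe_(v, w <- y) ((u ⊗ v) ⊗ w) : tens (tens_r r b) l).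
Proof.
split.
- move=> y; apply: (tsum_lin2 (F := fun u v w => (u ⊗ v) ⊗ w)) => v w.
  exact: lin_comp (bal_l (tpure_bal r b) v) (bal_l (tpure_bal (tens_r r b) l) w).
- by move=> u; exact: tsum_lin (tassoci_bal1 u).
- move=> u a y; move: y; apply: tens_ext.
  + exact: tsum_lin (tassoci_bal1 _).
  + exact: lin_comp (lact_linr (tens_l b l) a) (tsum_lin (tassoci_bal1 u)).
  + move=> v w; rewrite [lact (tens_l _ _) _ _]tens_lactE !(tsumE _ _ (tassoci_bal1 _)).
    by rewrite (bal_m (tpure_bal r b)).
Qed.

Lemma tassociE u v w : tassoci (u ⊗ (v ⊗ w)) = (u ⊗ v) ⊗ w.
Proof. by rewrite /tassoci (tsumE _ _ tassoci_bal) (tsumE _ _ (tassoci_bal1 u)). Qed.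

Lemma tassoci_lin : linear tassoci.
Proof. exact: tsum_lin tassoci_bal. Qed.

End Tassoc.

Lemma tens_ext_l (k : comPzRingType) (A B : kalgebra k) (U V W Z : lmodType k)
    (r : rmodule A U) (b : bimod A B V) (l : lmodule B W)
    (F G : tens (tens_r r b) l -> Z) : linear F -> linear G ->
  (forall u v w, F ((u ⊗ v) ⊗ w) = G ((u ⊗ v) ⊗ w)) -> forall t, F t = G t.
Proof.
move=> lF lG e; apply: tens_ext => // x w.
move: x; apply: (tens_ext (F := fun x => F (x ⊗ w)) (G := fun x => G (x ⊗ w))) => //.
- exact: lin_comp (bal_l (tpure_bal _ _) w) lF.
- exact: lin_comp (bal_l (tpure_bal _ _) w) lG.
Qed.

Lemma tens_ext_r (k : comPzRingType) (A B : kalgebra k) (U V W Z : lmodType k)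
    (r : rmodule A U) (b : bimod A B V) (l : lmodule B W)
    (F G : tens r (tens_l b l) -> Z) : linear F -> linear G ->
  (forall u v w, F (u ⊗ (v ⊗ w)) = G (u ⊗ (v ⊗ w))) -> forall t, F t = G t.
Proof.
move=> lF lG e; apply: tens_ext => // u y.
move: y; apply: (tens_ext (F := fun y => F (u ⊗ y)) (G := fun y => G (u ⊗ y))) => //.
- exact: lin_comp (bal_r (tpure_bal _ _) u) lF.
- exact: lin_comp (bal_r (tpure_bal _ _) u) lG.
Qed.

Section TensorLemmas.
Variable k : comPzRingType.

Lemma lin_tsum (A : kalgebra k) (V W Z Z' : lmodType k) (r : rmodule A V)
    (l : lmodule A W) (F : Z -> Z') (f : V -> W -> Z) (t : tens r l) :
  linear F -> F (tsum t f) = \swe_(v, w <- t) F (f v w).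
Proof. by move=> lF; rewrite /tsum lin_sum. Qed.

Lemma tsum_tmap (A : kalgebra k) (V W V' W' Z : lmodType k)
    (r : rmodule A V) (l : lmodule A W) (r' : rmodule A V') (l' : lmodule A W')
    (f : V -> V') (g : W -> W') (h : V' -> W' -> Z) (t : tens r l) :
  balanced r' l' h ->
  tsum (tmap f g t : tens r' l') h = \swe_(v, w <- t) h (f v) (g w).
Proof.
move=> bh; rewrite /tmap (lin_tsum _ _ (tsum_lin bh)).
by apply: tsum_ext => v w; rewrite tsumE.
Qed.

Lemma tmap_comp (A : kalgebra k) (V W V' W' V2 W2 : lmodType k)
    (r : rmodule A V) (l : lmodule A W) (r' : rmodule A V') (l' : lmodule A W')
    (r2 : rmodule A V2) (l2 : lmodule A W2)
    (f : V -> V') (g : W -> W') (f' : V' -> V2) (g' : W' -> W2) (t : tens r l) :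
  rhom r' r2 f' -> lhom l' l2 g' ->
  tmap f' g' (tmap f g t : tens r' l') =
  tmap (fun v => f' (f v)) (fun w => g' (g w)) t :> tens r2 l2.
Proof. by move=> hf hg; exact: tsum_tmap (tmap_bal hf hg). Qed.

Lemma tmap_ext (A : kalgebra k) (V W V' W' : lmodType k)
    (r : rmodule A V) (l : lmodule A W) (r' : rmodule A V') (l' : lmodule A W')
    (f f' : V -> V') (g g' : W -> W') (t : tens r l) :
  f =1 f' -> g =1 g' -> tmap f g t = tmap f' g' t :> tens r' l'.
Proof. by move=> ef eg; apply: tsum_ext => v w; rewrite ef eg. Qed.

Lemma tmap_id (A : kalgebra k) (V W : lmodType k)
    (r : rmodule A V) (l : lmodule A W) (t : tens r l) :
  tmap (fun v => v) (fun w => w) t = t.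
Proof. exact: esym (tens_repE t). Qed.

Lemma tmap_lin_f (A : kalgebra k) (V W V' W' : lmodType k)
    (r : rmodule A V) (l : lmodule A W) (r' : rmodule A V') (l' : lmodule A W')
    c (f f' : V -> V') (g : W -> W') (t : tens r l) :
  tmap (fun v => c *: f v + f' v) g t =
  c *: tmap f g t + tmap f' g t :> tens r' l'.
Proof.
rewrite /tmap /tsum scaler_sumr -big_split /=; apply: eq_bigr => p _.
exact: (bal_l (tpure_bal r' l')).
Qed.

Lemma tmap_0f (A : kalgebra k) (V W V' W' : lmodType k)
    (r : rmodule A V) (l : lmodule A W) (r' : rmodule A V') (l' : lmodule A W')
    (g : W -> W') (t : tens r l) :
  tmap (fun _ => 0) g t = 0 :> tens r' l'.
Proof.
rewrite /tmap /tsum big1 // => p _; exact: (lin0 (bal_l (tpure_bal r' l') _)).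
Qed.

Lemma bihom_id (A B : kalgebra k) (V : lmodType k) (b : bimod A B V) :
  bihom b b (fun x => x).
Proof. by split. Qed.

Lemma rhom_comp (A : kalgebra k) (U V W : lmodType k) (r : rmodule A U)
    (r' : rmodule A V) (r2 : rmodule A W) (f : U -> V) (g : V -> W) :
  rhom r r' f -> rhom r' r2 g -> rhom r r2 (fun x => g (f x)).
Proof.
move=> [lf hf] [lg hg]; split; first exact: lin_comp.
by move=> v a; rewrite hf hg.
Qed.

Lemma lhom_comp (A : kalgebra k) (U V W : lmodType k) (r : lmodule A U)
    (r' : lmodule A V) (r2 : lmodule A W) (f : U -> V) (g : V -> W) :
  lhom r r' f -> lhom r' r2 g -> lhom r r2 (fun x => g (f x)).
Proof.
move=> [lf hf] [lg hg]; split; first exact: lin_comp.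
by move=> a v; rewrite hf hg.
Qed.

Section Assoc.
Variables (A B : kalgebra k) (U V W : lmodType k).
Variables (r : rmodule A U) (b : bimod A B V) (l : lmodule B W).

Lemma tassocK : cancel (@tassoc _ _ _ _ _ _ r b l) (@tassoci _ _ _ _ _ _ r b l).
Proof.
apply: (@tens_ext_l _ _ _ _ _ _ _ _ _ _
  (fun t => tassoci (tassoc t)) (fun t => t)) => [||u v w].
- exact: lin_comp (@tassoc_lin _ _ _ _ _ _ r b l) (@tassoci_lin _ _ _ _ _ _ r b l).
- exact: lin_id.
- by rewrite tassocE tassociE.
Qed.

Lemma tassociK : cancel (@tassoci _ _ _ _ _ _ r b l) (@tassoc _ _ _ _ _ _ r b l).
Proof.
apply: (@tens_ext_r _ _ _ _ _ _ _ _ _ _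
  (fun t => tassoc (tassoci t)) (fun t => t)) => [||u v w].
- exact: lin_comp (@tassoci_lin _ _ _ _ _ _ r b l) (@tassoc_lin _ _ _ _ _ _ r b l).
- exact: lin_id.
- by rewrite tassociE tassocE.
Qed.
End Assoc.

Lemma tassoc_lhom (A0 A B : kalgebra k) (U V W : lmodType k)
    (r : bimod A0 A U) (b : bimod A B V) (l : lmodule B W) :
  lhom (tens_l (tens_b r b) l) (tens_l r (tens_l b l)) (@tassoc _ _ _ _ _ _ r b l).
Proof.
split; first exact: tassoc_lin.
move=> a; apply: tens_ext_l => [||u v w].
- exact: lin_comp (lact_linr (tens_l (tens_b r b) l) a) (@tassoc_lin _ _ _ _ _ _ r b l).
- exact: lin_comp (@tassoc_lin _ _ _ _ _ _ r b l) (lact_linr (tens_l r (tens_l b l)) a).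
- by rewrite /= tens_lactE /= tens_lactE !tassocE tens_lactE.
Qed.

Lemma tassoci_lhom (A0 A B : kalgebra k) (U V W : lmodType k)
    (r : bimod A0 A U) (b : bimod A B V) (l : lmodule B W) :
  lhom (tens_l r (tens_l b l)) (tens_l (tens_b r b) l) (@tassoci _ _ _ _ _ _ r b l).
Proof.
split; first exact: tassoci_lin.
by move=> a t; rewrite -[t in LHS]tassociK -(tassoc_lhom r b l).2 tassocK.
Qed.

Lemma tassoc_rhom (A B C : kalgebra k) (U V W : lmodType k)
    (r : rmodule A U) (b : bimod A B V) (l : bimod B C W) :
  rhom (tens_r (tens_r r b) l) (tens_r r (tens_b b l)) (@tassoc _ _ _ _ _ _ r b l).
Proof.
split; first exact: tassoc_lin.
move=> t a; move: t; apply: tens_ext_l => [||u v w].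
- exact: lin_comp (ract_linl (tens_r (tens_r r b) l) a) (@tassoc_lin _ _ _ _ _ _ r b l).
- exact: lin_comp (@tassoc_lin _ _ _ _ _ _ r b l) (ract_linl (tens_r r (tens_b b l)) a).
- by rewrite /= tens_ractE !tassocE tens_ractE /= tens_ractE.
Qed.

Lemma tassoci_rhom (A B C : kalgebra k) (U V W : lmodType k)
    (r : rmodule A U) (b : bimod A B V) (l : bimod B C W) :
  rhom (tens_r r (tens_b b l)) (tens_r (tens_r r b) l) (@tassoci _ _ _ _ _ _ r b l).
Proof.
split; first exact: tassoci_lin.
by move=> t a; rewrite -[t in LHS]tassociK -(tassoc_rhom r b l).2 tassocK.
Qed.

Lemma tmap_lhom (B A : kalgebra k) (V W V' W' : lmodType k)
    (r : bimod B A V) (l : lmodule A W) (r' : bimod B A V') (l' : lmodule A W')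
    f g : bihom r r' f -> lhom l l' g ->
  lhom (tens_l r l) (tens_l r' l') (tmap f g).
Proof.
move=> [lf fl fr] hg; have hf : rhom r r' f by [].
split; first exact: tmap_lin.
move=> a; apply: tens_ext.
- exact: lin_comp (lact_linr (tens_l r l) a) (tmap_lin hf hg).
- exact: lin_comp (tmap_lin hf hg) (lact_linr (tens_l r' l') a).
- by move=> v w; rewrite /= tens_lactE !(tmapE hf hg) tens_lactE fl.
Qed.

Lemma tmap_rhom (A B : kalgebra k) (V W V' W' : lmodType k)
    (r : rmodule A V) (l : bimod A B W) (r' : rmodule A V') (l' : bimod A B W')
    f g : rhom r r' f -> bihom l l' g ->
  rhom (tens_r r l) (tens_r r' l') (tmap f g).
Proof.
move=> hf [lg gl gr]; have hg : lhom l l' g by [].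
split; first exact: tmap_lin.
move=> t a; move: t; apply: tens_ext.
- exact: lin_comp (ract_linl (tens_r r l) a) (tmap_lin hf hg).
- exact: lin_comp (tmap_lin hf hg) (ract_linl (tens_r r' l') a).
- by move=> v w; rewrite /= tens_ractE !(tmapE hf hg) tens_ractE gr.
Qed.

End TensorLemmas.

Record coring_on (k : comPzRingType) (A : kalgebra k) (V : lmodType k) := CoringOn {
  cor_bm :> bimod A A V;
  cop : V -> tens cor_bm cor_bm;
  cou : V -> A;
  cop_bihom : bihom cor_bm (tens_b cor_bm cor_bm) cop;
  cou_bihom : bihom cor_bm (reg_bm A) cou;
  cop_coassoc : forall c,
    tassoc (tmap cop (fun x => x) (cop c)) = tmap (fun x => x) cop (cop c);
  cou_l : forall c, \swe_(c1, c2 <- cop c) lact cor_bm (cou c1) c2 = c;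
  cou_r : forall c, \swe_(c1, c2 <- cop c) ract cor_bm c1 (cou c2) = c }.

Record comodule_on (k : comPzRingType) (A : kalgebra k) (VC : lmodType k)
    (C : coring_on A VC) (V : lmodType k) := ComoduleOn {
  co_r :> rmodule A V;
  rho : V -> tens co_r C;
  rho_rhom : rhom co_r (tens_r co_r C) rho;
  rho_coassoc : forall m,
    tassoc (tmap rho (fun x => x) (rho m)) = tmap (fun x => x) (cop C) (rho m);
  rho_counit : forall m, \swe_(m0, m1 <- rho m) ract co_r m0 (cou C m1) = m }.

Definition colinear (k : comPzRingType) (A : kalgebra k) (VC : lmodType k)
    (C : coring_on A VC) (V W : lmodType k) (M : comodule_on C V)
    (N : comodule_on C W) (f : V -> W) :=
  rhom M N f /\ forall m, rho N (f m) = tmap f (fun c => c) (rho M m).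

Definition reg_co (k : comPzRingType) (A : kalgebra k) (V : lmodType k)
    (C : coring_on A V) : comodule_on C V :=
  @ComoduleOn k A V C V C (@cop _ _ _ C) (bihom_r (cop_bihom C))
    (@cop_coassoc _ _ _ C) (@cou_r _ _ _ C).

(* The last axiom is right D-colinearity of Delta_C, the coaction
   C ⊗_A tau_C of C ⊗_A C being written in C ⊗_A (C ⊗_L D). *)

Record coring_ext (k : comPzRingType) (A L : kalgebra k) (VC VD : lmodType k)
    (C : coring_on A VC) (D : coring_on L VD) := CoringExt {
  ext_co :> comodule_on D VC;
  ext_comm : forall a c l,
    ract ext_co (lact C a c) l = lact C a (ract ext_co c l);
  ext_tau_l : lhom C (tens_l (BiMod ext_comm) D) (rho ext_co);
  ext_cop_r : rhom ext_co (tens_r C (BiMod ext_comm)) (cop C);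
  ext_cop_col : forall c,
    tassoc (tmap (cop C) (fun d => d) (rho ext_co c)
              : tens (tens_r C (BiMod ext_comm)) D)
    = tmap (fun x => x) (rho ext_co) (cop C c) }.

Section Extension.
Variables (k : comPzRingType) (A L : kalgebra k) (VC VD : lmodType k).
Variables (C : coring_on A VC) (D : coring_on L VD) (E : coring_ext C D).

Definition ext_bm : bimod A L VC := BiMod (ext_comm E).

Section Action.
Variables (V : lmodType k) (M : comodule_on C V).

Definition ext_act (m : V) (x : L) : V :=
  \swe_(m0, m1 <- rho M m) ract M m0 (cou C (ract E m1 x)).

Lemma ext_act_bal x :
  balanced M C (fun m0 m1 => ract M m0 (cou C (ract E m1 x))).
Proof.
have [lc cl _] := cou_bihom C.
split.
- by move=> c; exact: ract_linl.
- move=> m; apply: lin_comp (ract_linr M m).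
  exact: lin_comp (ract_linl E x) lc.
- by move=> m a c; rewrite ext_comm cl ractA.
Qed.

Lemma rho_ext_act m x : rho M (ext_act m x) = ract (tens_r M ext_bm) (rho M m) x.
Proof.
have [lc cl cr] := cou_bihom C.
pose h (y : tens C C) : VC := \swe_(v, w <- y) ract C v (cou C (ract E w x)).
have bh : balanced C C (fun v w => ract C v (cou C (ract E w x))).
  split.
  - by move=> c; exact: ract_linl.
  - move=> m'; apply: lin_comp (ract_linr C m').
    exact: lin_comp (ract_linl E x) lc.
  - by move=> m' a c; rewrite ext_comm cl ractA.
have hh : lhom (tens_l C C) C h.
  split; first exact: tsum_lin.
  move=> a; apply: tens_ext.
  - exact: lin_comp (lact_linr (tens_l C C) a) (tsum_lin bh).
  - exact: lin_comp (tsum_lin bh) (lact_linr C a).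
  - by move=> v w; rewrite /= tens_lactE /h !tsumE // bm_comm.
have hcop c : h (cop C c) = ract E c x.
  rewrite -[RHS](cou_r C) (ext_cop_r E).2 /= /tens_ract tsum_tmap //.
  split.
  - by move=> w; exact: ract_linl.
  - by move=> v; apply: lin_comp (ract_linr C v).
  - by move=> v a w; rewrite cl ractA.
pose G (t : tens (tens_r M C) C) : tens M C :=
  \swe_(y, c <- t) ract (tens_r M C) y (cou C (ract E c x)).
have bG : balanced (tens_r M C) C
    (fun y c => ract (tens_r M C) y (cou C (ract E c x))).
  split.
  - by move=> c; exact: ract_linl.
  - move=> y; apply: lin_comp (ract_linr (tens_r M C) y).
    exact: lin_comp (ract_linl E x) lc.
  - by move=> y a c; rewrite ext_comm cl ractA.
have [lr rr] := rho_rhom M.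
have -> : rho M (ext_act m x) = G (tmap (rho M) (fun c => c) (rho M m)).
  rewrite /G tsum_tmap // /ext_act (lin_tsum _ _ lr).
  by apply: tsum_ext => v w; rewrite rr.
have eG t : G t = tmap (fun m => m) h (tassoc t).
  move: t; apply: tens_ext_l => [||u v w].
  - exact: tsum_lin.
  - exact: lin_comp (@tassoc_lin _ _ _ _ _ _ M C C) (tmap_lin (rhom_id M) hh).
  - rewrite tassocE (tmapE (rhom_id M) hh) /h /G !tsumE //.
    by rewrite [LHS]tens_ractE.
rewrite eG rho_coassoc (tmap_comp _ _ _ (rhom_id M) hh).
exact: tmap_ext.
Qed.

Lemma ext_act_linl x : linear (ext_act^~ x).
Proof. exact: lin_comp (rho_rhom M).1 (tsum_lin (ext_act_bal x)). Qed.

Lemma ext_act_linr m : linear (ext_act m).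
Proof.
apply: (tsum_lin2 (F := fun x m0 m1 => ract M m0 (cou C (ract E m1 x)))) => v w.
have [lc cl cr] := cou_bihom C.
apply: lin_comp (ract_linr M v).
exact: lin_comp (ract_linr E w) lc.
Qed.

Lemma ext_actA m x y : ext_act (ext_act m x) y = ext_act m (kmul L x y).
Proof.
rewrite [LHS]/ext_act rho_ext_act /= /tens_ract tsum_tmap; last exact: ext_act_bal.
by apply: tsum_ext => v w; rewrite ractA.
Qed.

Lemma ext_act1 m : ext_act m (kone L) = m.
Proof.
by rewrite -[RHS](rho_counit M); apply: tsum_ext => v w; rewrite ract1.
Qed.

Definition ext_rmod : rmodule L V :=
  RModule ext_act_linl ext_act_linr ext_actA ext_act1.

Lemma rho_ext_rhom : rhom ext_rmod (tens_r M ext_bm) (rho M).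
Proof. by split; [exact: (rho_rhom M).1 | exact: rho_ext_act]. Qed.

(* The equalizer of rho ⊗_A C and M ⊗_A Delta in right L-modules is preserved
   by - ⊗_L X.  Limits of modules are computed on underlying sets, and the
   common codomain is bracketed as M ⊗_A (C ⊗_A C). *)

Definition is_equalizer (X Y Z : Type) (j : X -> Y) (f g : Y -> Z) :=
  injective j /\ forall y, f y = g y <-> exists x, j x = y.

Definition eq_preserved (X : lmodType k) (lX : lmodule L X) :=
  is_equalizer
    (tmap (rho M) (fun x => x) : tens ext_rmod lX -> tens (tens_r M ext_bm) lX)
    (tmap (fun t => tassoc (tmap (rho M) (fun c => c) t)) (fun x => x)
       : _ -> tens (tens_r M (tens_b C ext_bm)) lX)
    (tmap (tmap (fun m => m) (cop C)) (fun x => x)).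

End Action.

Lemma colinear_ext_rhom (V W : lmodType k) (M : comodule_on C V)
    (N : comodule_on C W) f :
  colinear M N f -> rhom (ext_rmod M) (ext_rmod N) f.
Proof.
move=> [[lf fr] fc]; split=> // m x.
rewrite /= /ext_act (lin_tsum _ _ lf) fc tsum_tmap; last exact: ext_act_bal.
by apply: tsum_ext => v w; rewrite fr.
Qed.

End Extension.

Section PureAction.
Variables (k : comPzRingType) (A L : kalgebra k) (VC VD : lmodType k).
Variables (C : coring_on A VC) (D : coring_on L VD) (E : coring_ext C D).
Local Notation EB := (ext_bm E).

Section OneComodule.
Variables (V : lmodType k) (M : comodule_on C V).
Local Notation ML := (ext_rmod E M).
Hypothesis pM : eq_preserved E M (tens_l D D).

Lemma cop_lhom : lhom D (tens_l D D) (cop D).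
Proof. exact: bihom_l (cop_bihom D). Qed.

Let e (t : tens D D) : VD := \swe_(d1, d2 <- t) lact D (cou D d1) d2.

Let be : balanced D D (fun d1 d2 => lact D (cou D d1) d2).
Proof.
have [lc cl cr] := cou_bihom D; split.
- by move=> w; exact: lin_comp lc (lact_linl D w).
- by move=> v; exact: lact_linr.
- by move=> v a w; rewrite cr lactA.
Qed.

Let he : lhom (tens_l D D) D e.
Proof.
have [lc cl cr] := cou_bihom D.
split; first exact: tsum_lin.
move=> a; apply: tens_ext.
- exact: lin_comp (lact_linr (tens_l D D) a) (tsum_lin be).
- exact: lin_comp (tsum_lin be) (lact_linr D a).
- by move=> v w; rewrite /= tens_lactE /e !tsumE // cl lactA.
Qed.

Let hF : rhom (tens_r M EB) (tens_r M (tens_b C EB))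
  (fun t => tassoc (tmap (rho M) (fun c => c) t)).
Proof.
apply: (rhom_comp (r' := tens_r (tens_r M C) EB)).
  exact: (tmap_rhom (l := EB) (l' := EB) (rho_rhom M) (bihom_id EB)).
exact: (tassoc_rhom M C EB).
Qed.

Lemma cop_ext_bihom : bihom EB (tens_b C EB) (cop C).
Proof.
have [lc cl _] := cop_bihom C; split=> //.
exact: (ext_cop_r E).2.
Qed.

Let hG : rhom (tens_r M EB) (tens_r M (tens_b C EB))
  (tmap (fun m => m) (cop C)).
Proof. exact: (tmap_rhom (rhom_id M) cop_ext_bihom). Qed.

Lemma eq_preserved_retract : eq_preserved E M D.
Proof.
have hr := rho_ext_rhom E M; have hi := rhom_id ML.
have hMC := rhom_id (tens_r M EB).
have hMCC := rhom_id (tens_r M (tens_b C EB)).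
have hD : lhom D D (fun x : VD => x) := lhom_id D.
have hDD := lhom_id (tens_l D D).
have hc := cop_lhom.
have eD (d : VD) : e (cop D d) = d by exact: cou_l.
case: pM => inj eqz; split.
- move=> t t' ett'.
  have: tmap (fun x => x) (cop D) (tmap (rho M) (fun x => x) t : tens (tens_r M EB) D)
     = tmap (fun x => x) (cop D) (tmap (rho M) (fun x => x) t' : tens (tens_r M EB) D)
       :> tens (tens_r M EB) (tens_l D D) by rewrite ett'.
  rewrite !(tmap_comp _ _ _ hMC hc).
  rewrite -!(tmap_comp (r' := ML) (l' := tens_l D D) (fun x => x) (cop D) _ hr hDD) => /inj.
  move=> /(congr1 (tmap (r' := ML) (l' := D) (fun x => x) e)).
  have tE (u : tens ML D) : tmap (fun x => x) (fun d => e (cop D d)) u = u :> tens ML D.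
    by rewrite -[RHS]tmap_id; exact: tmap_ext.
  by rewrite !(tmap_comp _ _ _ hi he) => e1; rewrite -[t]tE -[t']tE.
- move=> y; split; last first.
    move=> [x <-]; rewrite (tmap_comp _ _ _ hF hD) (tmap_comp _ _ _ hG hD).
    by apply: tmap_ext => // m; exact: rho_coassoc.
  move=> fg.
  have: exists x : tens ML (tens_l D D), tmap (rho M) (fun x => x) x = tmap (fun x => x) (cop D) y
    :> tens (tens_r M EB) (tens_l D D).
    apply/eqz; rewrite (tmap_comp _ _ _ hF hDD) (tmap_comp _ _ _ hG hDD).
    have := congr1 (tmap (r' := tens_r M (tens_b C EB)) (l' := tens_l D D)
      (fun x => x) (cop D)) fg.
    by rewrite !(tmap_comp _ _ _ hMCC hc).
  move=> [x ex]; exists (tmap (fun x => x) e x).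
  rewrite (tmap_comp _ _ _ hr hD).
  rewrite -(tmap_comp (r' := tens_r M EB) (l' := tens_l D D) _ _ _ hMC he) ex.
  rewrite (tmap_comp _ _ _ hMC he) -[RHS]tmap_id.
  exact: tmap_ext.
Qed.

Definition tauJ (X : lmodType k) (lX : lmodule L X) (t : tens ML lX) :
  tens M (tens_l EB lX) := tassoc (tmap (rho M) (fun x => x) t : tens (tens_r M EB) lX).

Lemma tauJ_lin (X : lmodType k) (lX : lmodule L X) : linear (tauJ (lX := lX)).
Proof.
apply: lin_comp (tmap_lin (rho_ext_rhom E M) (lhom_id lX)) _.
exact: tassoc_lin.
Qed.

Lemma tauJE (X : lmodType k) (lX : lmodule L X) v (x : X) :
  tauJ (v ⊗ x) = tassoc (rho M v ⊗ x : tens (tens_r M EB) lX).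
Proof. by rewrite /tauJ (tmapE (rho_ext_rhom E M) (lhom_id lX)). Qed.

Lemma tauJ_inj : injective (tauJ (lX := D)).
Proof.
by move=> t t' /(can_inj (@tassocK _ _ _ _ _ _ _ _ _)) /(eq_preserved_retract.1).
Qed.

Lemma tauJ_inj2 : injective (tauJ (lX := tens_l D D)).
Proof. by move=> t t' /(can_inj (@tassocK _ _ _ _ _ _ _ _ _)) /(pM.1). Qed.

Lemma ext_tau_ex m : exists t : tens ML D,
  tauJ t = tmap (fun x => x) (rho E) (rho M m).
Proof.
have ht : lhom C (tens_l EB D) (rho E) := ext_tau_l E.
have hM := rhom_id M.
set z := tmap _ (rho E) (rho M m) : tens M (tens_l EB D).
have [x ex] : exists x : tens ML D, tmap (rho M) (fun x => x) x = tassoci z :> tens (tens_r M EB) D.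
  apply/eq_preserved_retract.2.
  have hK : lhom (tens_l (tens_b C EB) D) (tens_l C (tens_l EB D))
      (@tassoc _ _ _ _ _ _ C EB D) := tassoc_lhom C EB D.
  have hK' : lhom (tens_l C (tens_l EB D)) (tens_l (tens_b C EB) D)
      (@tassoci _ _ _ _ _ _ C EB D) := tassoci_lhom C EB D.
  pose K (t : tens (tens_r M (tens_b C EB)) D) : tens M (tens_l C (tens_l EB D)) :=
    tmap (fun x => x) (@tassoc _ _ _ _ _ _ C EB D) (tassoc t).
  have injK : injective K.
    apply: inj_comp (can_inj (@tassocK _ _ _ _ _ _ M (tens_b C EB) D)).
    apply: (@can_inj _ _ _ (tmap (fun x => x) (@tassoci _ _ _ _ _ _ C EB D))) => t.
    rewrite (tmap_comp _ _ _ hM hK') -[RHS]tmap_id.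
    by apply: tmap_ext => // x; exact: tassocK.
  have linK : linear K.
    exact: lin_comp (@tassoc_lin _ _ _ _ _ _ M (tens_b C EB) D) (tmap_lin hM hK).
  have hD : lhom D D (fun x : VD => x) := lhom_id D.
  have hDX : lhom (tens_l EB D) (tens_l EB D) (fun x => x) := lhom_id _.
  apply: injK.
  pose T1 (z : tens M (tens_l EB D)) := K (tmap (fun t => tassoc (tmap (rho M) (fun c => c) t))
     (fun x => x) (tassoci z)).
  pose T2 (z : tens M (tens_l EB D)) := K (tmap (tmap (fun m => m) (cop C)) (fun x => x) (tassoci z)).
  have e1 u : T1 u = tassoc (tmap (rho M) (fun x => x) u : tens (tens_r M C) (tens_l EB D)).
    move: u; apply: tens_ext_r => [||u c d].
    - exact: lin_comp (lin_comp (@tassoci_lin _ _ _ _ _ _ M EB D) (tmap_lin hF hD)) linK.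
    - exact: lin_comp (tmap_lin (rho_rhom M) hDX) (@tassoc_lin _ _ _ _ _ _ M C (tens_l EB D)).
    - rewrite /T1 tassociE (tmapE hF hD) (tmapE (rho_rhom M) hDX).
      rewrite (tmapE (rho_rhom M) (lhom_id _)).
      move: (rho M u); apply: tens_ext.
      + exact: lin_comp (lin_comp (lin_comp (bal_l (tpure_bal (tens_r M C) EB) c)
          (@tassoc_lin _ _ _ _ _ _ M C EB))
          (bal_l (tpure_bal (tens_r M (tens_b C EB)) D) d)) linK.
      + exact: lin_comp (bal_l (tpure_bal (tens_r M C) (tens_l EB D)) (c ⊗ d))
          (@tassoc_lin _ _ _ _ _ _ M C (tens_l EB D)).
      + by move=> v w; rewrite /K !tassocE (tmapE hM hK) !tassocE.
  have e2 u : T2 u = tmap (fun x => x)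
     (fun y => tassoc (tmap (cop C) (fun x => x) y : tens (tens_r C EB) D)) u.
    have hcc : lhom (tens_l EB D) (tens_l C (tens_l EB D))
       (fun y => tassoc (tmap (cop C) (fun x => x) y : tens (tens_r C EB) D)).
      apply: (lhom_comp (r' := tens_l (tens_b C EB) D)) hK.
      exact: (tmap_lhom cop_ext_bihom hD).
    move: u; apply: tens_ext_r => [||u c d].
    - exact: lin_comp (lin_comp (@tassoci_lin _ _ _ _ _ _ M EB D) (tmap_lin hG hD)) linK.
    - exact: tmap_lin hM hcc.
    - rewrite /T2 tassociE (tmapE hG hD) (tmapE hM hcc).
      rewrite (tmapE hM (bihom_l (cop_bihom C))).
      by rewrite (tmapE (bihom_r cop_ext_bihom) hD) /K tassocE (tmapE hM hK).
  rewrite -/(T1 z) -/(T2 z) e1 e2 /z.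
  have hcc : lhom (tens_l EB D) (tens_l C (tens_l EB D))
     (fun y => tassoc (tmap (cop C) (fun x => x) y : tens (tens_r C EB) D)).
    apply: (lhom_comp (r' := tens_l (tens_b C EB) D)) hK.
    exact: (tmap_lhom cop_ext_bihom hD).
  rewrite (tmap_comp _ _ _ (rho_rhom M) hDX) (tmap_comp _ _ _ hM hcc).
  have hCt : lhom (tens_l C C) (tens_l C (tens_l EB D)) (tmap (fun x => x) (rho E)).
    exact: (tmap_lhom (bihom_id C) ht).
  rewrite [RHS](_ : _ = tmap (fun x => x) (fun c => tmap (fun x => x) (rho E) (cop C c)) (rho M m)); last first.
    by apply: tmap_ext => // c; exact: ext_cop_col.
  rewrite -(tmap_comp (r' := M) (l' := tens_l C C) _ _ _ hM hCt) -rho_coassoc.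
  have en (t : tens (tens_r M C) C) : tmap (fun x => x) (tmap (fun x => x) (rho E)) (tassoc t) =
     tassoc (tmap (fun x => x) (rho E) t : tens (tens_r M C) (tens_l EB D)) :> tens M (tens_l C (tens_l EB D)).
    have hMC := rhom_id (tens_r M C).
    move: t; apply: tens_ext_l => [||u v w].
    - exact: lin_comp (@tassoc_lin _ _ _ _ _ _ M C C) (tmap_lin hM hCt).
    - exact: lin_comp (tmap_lin hMC ht) (@tassoc_lin _ _ _ _ _ _ M C (tens_l EB D)).
    - rewrite tassocE (tmapE hM hCt) (tmapE hMC ht) (tmapE (rhom_id C) ht).
      by rewrite tassocE.
  by rewrite en (tmap_comp _ _ _ (rhom_id (tens_r M C)) ht).
by exists x; rewrite /tauJ ex tassociK.
Qed.

(* The coaction tau_M, formally m^[0] eps(m^[1]_[0]) ⊗_L m^[1]_[1].  As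
   (m ⊗_A c) ⊗_L d |-> m eps(c) ⊗_L d is not defined on all of
   M ⊗_A C ⊗_L D, the expression is to be read through the isomorphism of
   M ⊗_L D onto the equalizer provided by purity: see [ext_tauE] and
   [ext_tau_sweedler]. *)
Definition ext_tau (m : V) : tens ML D := sval (cid (ext_tau_ex m)).

Lemma ext_tauE m : tauJ (ext_tau m) = tmap (fun x => x) (rho E) (rho M m).
Proof. exact: svalP (cid (ext_tau_ex m)). Qed.

Lemma rho_equalizer (y : tens M C) :
  tassoc (tmap (rho M) (fun c => c) y) = tmap (fun m => m) (cop C) y ->
  rho M (\swe_(m0, m1 <- y) ract M m0 (cou C m1)) = y.
Proof.
have [lc cl cr] := cou_bihom C; have [lr rr] := rho_rhom M.
pose h (z : tens C C) : VC := \swe_(v, w <- z) ract C v (cou C w).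
have bh : balanced C C (fun v w => ract C v (cou C w)).
  split.
  - by move=> c; exact: ract_linl.
  - by move=> v; exact: lin_comp lc (ract_linr C v).
  - by move=> v a w; rewrite cl ractA.
have hh : lhom (tens_l C C) C h.
  split; first exact: tsum_lin.
  move=> a; apply: tens_ext.
  - exact: lin_comp (lact_linr (tens_l C C) a) (tsum_lin bh).
  - exact: lin_comp (tsum_lin bh) (lact_linr C a).
  - by move=> v w; rewrite /= tens_lactE /h !tsumE // bm_comm.
have bM : balanced M C (fun v w => ract M v (cou C w)).
  split.
  - by move=> c; exact: ract_linl.
  - by move=> v; exact: lin_comp lc (ract_linr M v).
  - by move=> v a w; rewrite cl ractA.
have hM := rhom_id M.
move=> /(congr1 (tmap (r' := M) (l' := C) (fun m => m) h)).
rewrite (tmap_comp _ _ _ hM hh) => e1.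
have e2 : tmap (fun m => m) (fun c => h (cop C c)) y = y.
  by rewrite -[RHS]tmap_id; apply: tmap_ext => // c; exact: cou_r.
rewrite -[RHS]e2 -e1; move: y {e1 e2}; apply: tens_ext.
- exact: lin_comp (tsum_lin bM) lr.
- exact: lin_comp (tmap_lin (rho_rhom M) (lhom_id C))
    (lin_comp (@tassoc_lin _ _ _ _ _ _ M C C) (tmap_lin hM hh)).
- move=> v w; rewrite tsumE // rr (tmapE (rho_rhom M) (lhom_id C)).
  move: (rho M v); apply: tens_ext.
  + exact: ract_linl.
  + exact: lin_comp (bal_l (tpure_bal (tens_r M C) C) w)
      (lin_comp (@tassoc_lin _ _ _ _ _ _ M C C) (tmap_lin hM hh)).
  + by move=> u c; rewrite tassocE (tmapE hM hh) /= tens_ractE /h tsumE.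
Qed.

Lemma ext_tau_sweedler m (s : seq (tens M C * VD)) :
  {in s, forall p, tassoc (tmap (rho M) (fun c => c) p.1)
                   = tmap (fun m => m) (cop C) p.1} ->
  tmap (fun m => m) (rho E) (rho M m) =
    \sum_(p <- s) tassoc (p.1 ⊗ p.2 : tens (tens_r M EB) D) ->
  ext_tau m = \sum_(p <- s) (\swe_(m0, m1 <- p.1) ract M m0 (cou C m1)) ⊗ p.2.
Proof.
move=> sE em; apply: tauJ_inj; rewrite ext_tauE em (lin_sum _ _ (tauJ_lin (lX := D))).
rewrite [RHS]big_seq [LHS]big_seq; apply: eq_bigr => p ps.
by rewrite tauJE rho_equalizer //; exact: sE.
Qed.

Lemma rho_inj : injective (rho M).
Proof. by move=> m m' e1; rewrite -(rho_counit M m) e1 rho_counit. Qed.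

Lemma tauJ_rhom : rhom (tens_r ML D) (tens_r M (tens_b EB D)) (tauJ (lX := D)).
Proof.
apply: (rhom_comp (r' := tens_r (tens_r M EB) D)).
  exact: (tmap_rhom (rho_ext_rhom E M) (bihom_id D)).
exact: (tassoc_rhom M EB D).
Qed.

Lemma rho_ext_bihom : bihom EB (tens_b EB D) (rho E).
Proof.
split; [exact: (rho_rhom E).1 | exact: (ext_tau_l E).2 | exact: (rho_rhom E).2].
Qed.

Lemma ext_tau_rhom : rhom ML (tens_r ML D) ext_tau.
Proof.
have ht := tmap_rhom (rhom_id M) rho_ext_bihom.
have lt := lin_comp (rho_rhom M).1 ht.1.
split.
- move=> c x y; apply: tauJ_inj; rewrite (tauJ_lin (lX := D)) !ext_tauE.
  exact: lt.
- move=> v a; apply: tauJ_inj; rewrite tauJ_rhom.2 !ext_tauE.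
  by rewrite (rho_ext_rhom E M).2 ht.2.
Qed.

Lemma tauJ_nat (X Y : lmodType k) (lX : lmodule L X) (lY : lmodule L Y) g
    (t : tens ML lX) : lhom lX lY g ->
  tauJ (tmap (fun m => m) g t : tens ML lY) =
  tmap (fun m => m) (tmap (fun c => c) g : tens EB lX -> tens EB lY) (tauJ t).
Proof.
move=> hg; have hi := rhom_id ML; have hM := rhom_id M.
have h2 : lhom (tens_l EB lX) (tens_l EB lY) (tmap (fun c => c) g).
  exact: (tmap_lhom (bihom_id EB) hg).
move: t; apply: tens_ext.
- exact: lin_comp (tmap_lin hi hg) (tauJ_lin (lX := lY)).
- exact: lin_comp (tauJ_lin (lX := lX)) (tmap_lin hM h2).
- move=> v x; rewrite (tmapE hi hg) !tauJE; move: (rho M v); apply: tens_ext.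
  + exact: lin_comp (bal_l (tpure_bal (tens_r M EB) lY) (g x)) (@tassoc_lin _ _ _ _ _ _ M EB lY).
  + exact: lin_comp (lin_comp (bal_l (tpure_bal (tens_r M EB) lX) x)
      (@tassoc_lin _ _ _ _ _ _ M EB lX)) (tmap_lin hM h2).
  + by move=> u c; rewrite !tassocE (tmapE hM h2) (tmapE (rhom_id EB) hg).
Qed.

Lemma ext_tau_coassoc m :
  tassoc (tmap ext_tau (fun d => d) (ext_tau m) : tens (tens_r ML D) D) =
  tmap (fun m => m) (cop D) (ext_tau m).
Proof.
have hM := rhom_id M; have hD := lhom_id D; have ht := ext_tau_rhom.
have lE := @tassoc_lin _ _ _ _ _ _ E D D.
have lML := @tassoc_lin _ _ _ _ _ _ ML D D.
apply: tauJ_inj2; rewrite (tauJ_nat _ cop_lhom) ext_tauE.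
have hc : lhom (tens_l EB D) (tens_l EB (tens_l D D)) (tmap (fun c => c) (cop D)).
  exact: (tmap_lhom (bihom_id EB) cop_lhom).
rewrite (tmap_comp _ _ _ hM hc).
pose H (y : tens EB D) : tens EB (tens_l D D) :=
  tassoc (tmap (rho E) (fun d => d) y : tens (tens_r EB D) D).
have hH : lhom (tens_l EB D) (tens_l EB (tens_l D D)) H.
  apply: (lhom_comp (r' := tens_l (tens_b EB D) D)) (tassoc_lhom EB D D).
  exact: (tmap_lhom rho_ext_bihom hD).
pose S d (y : tens EB D) : tens EB (tens_l D D) := tassoc (y ⊗ d : tens (tens_r EB D) D).
have hS d : lhom (tens_l EB D) (tens_l EB (tens_l D D)) (S d).
  apply: (lhom_comp (r' := tens_l (tens_b EB D) D)) (tassoc_lhom EB D D).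
  split; first exact: (bal_l (tpure_bal (tens_r EB D) D) d).
  by move=> a y; rewrite /= tens_lactE.
have e1 d (x : tens ML D) : tauJ (tassoc (x ⊗ d : tens (tens_r ML D) D)) =
    tmap (fun m => m) (S d) (tauJ x).
  move: x; apply: tens_ext.
  - exact: lin_comp (lin_comp (bal_l (tpure_bal (tens_r ML D) D) d) lML)
      (tauJ_lin (lX := tens_l D D)).
  - exact: lin_comp (tauJ_lin (lX := D)) (tmap_lin hM (hS d)).
  - move=> v x; rewrite tassocE !tauJE; move: (rho M v); apply: tens_ext.
    + exact: lin_comp (bal_l (tpure_bal (tens_r M EB) (tens_l D D)) (x ⊗ d))
        (@tassoc_lin _ _ _ _ _ _ M EB (tens_l D D)).
    + exact: lin_comp (lin_comp (bal_l (tpure_bal (tens_r M EB) D) x)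
        (@tassoc_lin _ _ _ _ _ _ M EB D)) (tmap_lin hM (hS d)).
    + by move=> u c; rewrite !tassocE (tmapE hM (hS d)) /S tassocE.
have e2 (t : tens ML D) :
    tauJ (tassoc (tmap ext_tau (fun d => d) t : tens (tens_r ML D) D)) =
    tmap (fun m => m) H (tauJ t).
  move: t; apply: tens_ext.
  - exact: lin_comp (lin_comp (tmap_lin ht hD) lML) (tauJ_lin (lX := tens_l D D)).
  - exact: lin_comp (tauJ_lin (lX := D)) (tmap_lin hM hH).
  - move=> v d; rewrite (tmapE ht hD) e1 ext_tauE tauJE.
    move: (rho M v); apply: tens_ext.
    + exact: lin_comp (tmap_lin hM (bihom_l rho_ext_bihom)) (tmap_lin hM (hS d)).
    + exact: lin_comp (lin_comp (bal_l (tpure_bal (tens_r M EB) D) d)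
        (@tassoc_lin _ _ _ _ _ _ M EB D)) (tmap_lin hM hH).
    + move=> u c; rewrite tassocE (tmapE hM (bihom_l rho_ext_bihom)).
      rewrite (tmapE hM (hS d)) (tmapE hM hH) /H.
      by rewrite (tmapE (bihom_r rho_ext_bihom) hD).
rewrite e2 ext_tauE (tmap_comp _ _ _ hM hH).
by apply: tmap_ext => // c; exact: (rho_coassoc E).
Qed.

Lemma ext_tau_counit m : \swe_(m0, d <- ext_tau m) ract ML m0 (cou D d) = m.
Proof.
have [lc cl cr] := cou_bihom D.
have hM := rhom_id M.
have bM : balanced ML D (fun v d => ract ML v (cou D d)).
  split.
  - by move=> d; exact: ract_linl.
  - by move=> v; exact: lin_comp lc (ract_linr ML v).
  - by move=> v a d; rewrite cl ractA.
have bE : balanced EB D (fun c d => ract EB c (cou D d)).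
  split.
  - by move=> d; exact: ract_linl.
  - by move=> v; exact: lin_comp lc (ract_linr EB v).
  - by move=> v a d; rewrite cl ractA.
pose h (y : tens EB D) : VC := \swe_(c, d <- y) ract EB c (cou D d).
have hh : lhom (tens_l EB D) EB h.
  split; first exact: tsum_lin.
  move=> a; apply: tens_ext.
  - exact: lin_comp (lact_linr (tens_l EB D) a) (tsum_lin bE).
  - exact: lin_comp (tsum_lin bE) (lact_linr EB a).
  - by move=> v w; rewrite /= tens_lactE /h !tsumE // bm_comm.
apply: rho_inj.
have e1 (t : tens ML D) : rho M (\swe_(m0, d <- t) ract ML m0 (cou D d)) =
    tmap (fun m => m) h (tauJ t).
  move: t; apply: tens_ext.
  - exact: lin_comp (tsum_lin bM) (rho_rhom M).1.
  - exact: lin_comp (tauJ_lin (lX := D)) (tmap_lin hM hh).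
  - move=> v d; rewrite tsumE // (rho_ext_rhom E M).2 tauJE.
    move: (rho M v); apply: tens_ext.
    + exact: ract_linl.
    + exact: lin_comp (lin_comp (bal_l (tpure_bal (tens_r M EB) D) d)
        (@tassoc_lin _ _ _ _ _ _ M EB D)) (tmap_lin hM hh).
    + by move=> u c; rewrite tassocE (tmapE hM hh) /h tsumE // /= tens_ractE.
rewrite e1 ext_tauE (tmap_comp _ _ _ hM hh) -[RHS]tmap_id.
by apply: tmap_ext => // c; exact: (rho_counit E).
Qed.

Definition ext_comod : comodule_on D V :=
  ComoduleOn ext_tau_rhom ext_tau_coassoc ext_tau_counit.

End OneComodule.

Lemma ext_colinear (V W : lmodType k) (M : comodule_on C V)
    (N : comodule_on C W) (pM : eq_preserved E M (tens_l D D))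
    (pN : eq_preserved E N (tens_l D D)) f :
  colinear M N f -> colinear (ext_comod pM) (ext_comod pN) f.
Proof.
move=> cf; have hf := colinear_ext_rhom E cf; split=> // m /=.
apply: (tauJ_inj pN); rewrite ext_tauE.
case: cf => [fr fc].
have hD := lhom_id D; have hED := lhom_id (tens_l EB D).
have hM := rhom_id N.
have e1 (t : tens (ext_rmod E M) D) :
    tauJ (tmap f (fun d => d) t : tens (ext_rmod E N) D) =
    tmap f (fun y => y) (tauJ t) :> tens N (tens_l EB D).
  move: t; apply: tens_ext.
  - exact: lin_comp (tmap_lin hf hD) (tauJ_lin (M := N) (lX := D)).
  - exact: lin_comp (tauJ_lin (M := M) (lX := D)) (tmap_lin fr hED).
  - move=> v d; rewrite (tmapE hf hD) !tauJE fc.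
    move: (rho M v); apply: tens_ext.
    + exact: lin_comp (lin_comp (tmap_lin fr (lhom_id C)) (bal_l (tpure_bal (tens_r N EB) D) d))
        (@tassoc_lin _ _ _ _ _ _ N EB D).
    + exact: lin_comp (lin_comp (bal_l (tpure_bal (tens_r M EB) D) d)
        (@tassoc_lin _ _ _ _ _ _ M EB D)) (tmap_lin fr hED).
    + by move=> u c; rewrite (tmapE fr (lhom_id C)) !tassocE (tmapE fr hED).
rewrite e1 ext_tauE fc (tmap_comp _ _ _ fr hED).
by rewrite (tmap_comp _ _ _ hM (bihom_l (rho_ext_bihom))).
Qed.

End PureAction.

(* k-modules with carriers in a universe strictly below that of [lmodType k].
   Corings and comodules in the categorical part have such carriers, so that
   the natural transformations between functors on comodules form a
   [lmodType k]. *)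

Record kmod (k : comPzRingType) := KMod {
  kmod_sort :> Type;
  kmod_class : GRing.Lmodule k kmod_sort }.

HB.instance Definition _ (k : comPzRingType) (M : kmod k) :=
  GRing.Lmodule.copy (kmod_sort M) (GRing.Lmodule.Pack (kmod_class M)).

Definition kmod_lmod (k : comPzRingType) (M : kmod k) : lmodType k := kmod_sort M.
Coercion kmod_lmod : kmod >-> lmodType.

Definition ktens (k : comPzRingType) (A : kalgebra k) (V W : kmod k)
    (r : rmodule A V) (l : lmodule A W) : kmod k :=
  @KMod k {s : seq (kmod_sort V * kmod_sort W) | tens_canon r l s = s}
    (GRing.Lmodule.class (tens r l)).

Definition funclosed (k : comPzRingType) (X : Type) (Y : X -> lmodType k)
    (P : (forall x, Y x) -> Prop) :=
  P (fun=> 0) /\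
  forall (c : k) f g, P f -> P g -> P (fun x => c *: f x + g x).

Section Funsub.
Variables (k : comPzRingType) (X : Type) (Y : X -> lmodType k).
Variable P : (forall x, Y x) -> Prop.

Definition funsub of funclosed P : Type := {f | P f}.

Variable PP : funclosed P.
Local Notation T := (funsub PP).

HB.instance Definition _ := gen_eqMixin T.
HB.instance Definition _ := gen_choiceMixin T.

Lemma funsub_eq (f g : T) : (forall x, sval f x = sval g x) -> f = g.
Proof.
case: f g => [f Pf] [g Pg] /= e; apply: eq_exist.
exact: functional_extensionality_dep.
Qed.

Let addP f g : P f -> P g -> P (fun x => f x + g x).
Proof.
move=> Pf Pg; have := PP.2 1 _ _ Pf Pg; congr P.
by apply: functional_extensionality_dep => x; rewrite scale1r.
Qed.
Let sclP c f : P f -> P (fun x => c *: f x).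
Proof.
move=> Pf; have := PP.2 c _ _ Pf PP.1; congr P.
by apply: functional_extensionality_dep => x; rewrite addr0.
Qed.

Definition funsub_zero : T := exist P _ PP.1.
Definition funsub_add (f g : T) : T := exist P _ (addP (svalP f) (svalP g)).
Definition funsub_scl c (f : T) : T := exist P _ (sclP c (svalP f)).

Lemma funsub_addA : associative funsub_add.
Proof. by move=> f g h; apply: funsub_eq => x; exact: addrA. Qed.
Lemma funsub_addC : commutative funsub_add.
Proof. by move=> f g; apply: funsub_eq => x; exact: addrC. Qed.
Lemma funsub_add0 : left_id funsub_zero funsub_add.
Proof. by move=> f; apply: funsub_eq => x; exact: add0r. Qed.
Lemma funsub_addN : left_inverse funsub_zero (funsub_scl (-1)) funsub_add.
Proof. by move=> f; apply: funsub_eq => x /=; rewrite scaleN1r addNr. Qed.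

HB.instance Definition _ :=
  GRing.isZmodule.Build T funsub_addA funsub_addC funsub_add0 funsub_addN.

Lemma funsub_sclA a b f : funsub_scl a (funsub_scl b f) = funsub_scl (a * b) f.
Proof. by apply: funsub_eq => x; exact: scalerA. Qed.
Lemma funsub_scl1 : left_id 1 funsub_scl.
Proof. by move=> f; apply: funsub_eq => x; exact: scale1r. Qed.
Lemma funsub_sclDr : right_distributive funsub_scl +%R.
Proof. by move=> c f g; apply: funsub_eq => x; exact: scalerDr. Qed.
Lemma funsub_sclDl f : {morph funsub_scl^~ f : a b / a + b}.
Proof. by move=> a b; apply: funsub_eq => x; exact: scalerDl. Qed.

HB.instance Definition _ := GRing.Zmodule_isLmodule.Build k T
  funsub_sclA funsub_scl1 funsub_sclDr funsub_sclDl.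

End Funsub.

Notation "f $ x" := (sval f x) (at level 11, left associativity).

Section Closure.
Variable k : comPzRingType.
Implicit Types (A B : kalgebra k) (V W : lmodType k).

Lemma linear_closed V W : funclosed (fun f : V -> W => linear f).
Proof.
split=> [c x y|c f g lf lg]; first by rewrite scaler0 addr0.
exact: lin_add (lin_cstZ c lf) lg.
Qed.

Lemma lhom_closed A V W (l : lmodule A V) (l' : lmodule A W) :
  funclosed (lhom l l').
Proof.
have [l0 lD] := linear_closed V W.
split=> [|c f g [lf hf] [lg hg]]; split=> //; try exact: lD.
  by move=> a v; rewrite (lin0 (lact_linr l' a)).
by move=> a v; rewrite hf hg (lact_linr l' a).
Qed.

Lemma rhom_closed A V W (r : rmodule A V) (r' : rmodule A W) :
  funclosed (rhom r r').
Proof.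
have [l0 lD] := linear_closed V W.
split=> [|c f g [lf hf] [lg hg]]; split=> //; try exact: lD.
  by move=> v a; rewrite (lin0 (ract_linl r' a)).
by move=> v a; rewrite hf hg (ract_linl r' a).
Qed.

Lemma bihom_closed A B V W (b : bimod A B V) (b' : bimod A B W) :
  funclosed (bihom b b').
Proof.
have [l0 lD] := lhom_closed b b'; have [r0 rD] := rhom_closed b b'.
split=> [|c f g [lf fl fr] [lg gl gr]].
  by case: l0 => ? ?; case: r0 => ? ?; split.
have [? ?] := lD c f g (conj lf fl) (conj lg gl).
by have [? ?] := rD c f g (conj lf fr) (conj lg gr); split.
Qed.

Lemma colinear_closed A VC (C : coring_on A VC) V W
    (M : comodule_on C V) (N : comodule_on C W) : funclosed (colinear M N).
Proof.
have [r0 rD] := rhom_closed M N; have lr := (rho_rhom N).1.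
split=> [|c f g [hf cf] [hg cg]].
  by split=> // m; rewrite tmap_0f (lin0 lr).
split=> [|m]; first exact: rD.
by rewrite tmap_lin_f lr cf cg.
Qed.

End Closure.

Record coring (k : comPzRingType) (A : kalgebra k) := Coring {
  cor_mod :> kmod k;
  cor_str :> coring_on A cor_mod }.

Record comodule (k : comPzRingType) (A : kalgebra k) (C : coring A) := Comodule {
  co_mod :> kmod k;
  co_str :> comodule_on C co_mod }.

Section Category.
Variables (k : comPzRingType) (A : kalgebra k) (C : coring A).
Implicit Types M N P : comodule C.

Definition chom M N : kmod k :=
  @KMod k {f : kmod_sort M -> kmod_sort N | colinear M N f}
    (GRing.Lmodule.class (funsub (colinear_closed M N))).

Lemma chom_eq M N (f g : chom M N) : (forall x, f $ x = g $ x) -> f = g.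
Proof. exact: (@funsub_eq _ _ _ _ (colinear_closed M N)). Qed.

Lemma colinear_id (V : lmodType k) (M : comodule_on C V) :
  colinear M M (fun x => x).
Proof. by split=> [|m]; [exact: rhom_id | rewrite tmap_id]. Qed.

Lemma colinear_comp (U V W : lmodType k) (M : comodule_on C U)
    (N : comodule_on C V) (P : comodule_on C W) f g :
  colinear M N f -> colinear N P g -> colinear M P (fun x => g (f x)).
Proof.
move=> [hf cf] [hg cg]; split=> [|m]; first exact: rhom_comp hf hg.
by rewrite cg cf (tmap_comp _ _ _ hg (lhom_id C)).
Qed.

Definition cid_hom M : chom M M := exist _ _ (colinear_id M).

Definition ccomp M N P (g : chom N P) (f : chom M N) : chom M P :=
  exist _ _ (colinear_comp (svalP f) (svalP g)).

Lemma ccomp_linl M N P (f : chom M N) : linear ((@ccomp M N P)^~ f).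
Proof. by move=> c g g'; exact: chom_eq. Qed.

Lemma ccomp_linr M N P (g : chom N P) : linear (@ccomp M N P g).
Proof. by move=> c f f'; apply: chom_eq => x; exact: (svalP g).1.1. Qed.

End Category.

Record functor (k : comPzRingType) (A L : kalgebra k) (C : coring A)
    (D : coring L) := Functor {
  fobj :> comodule C -> comodule D;
  fmap : forall M N, chom M N -> chom (fobj M) (fobj N);
  fmap_lin : forall M N, linear (@fmap M N);
  fmap_id : forall M, fmap (cid_hom M) = cid_hom (fobj M);
  fmap_comp : forall M N P (g : chom N P) (f : chom M N),
    fmap (ccomp g f) = ccomp (fmap g) (fmap f) }.

Section Nat.
Variables (k : comPzRingType) (A L : kalgebra k) (C : coring A) (D : coring L).
Implicit Types F G H : functor C D.

Definition natural F G (n : forall M, chom (F M) (G M)) :=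
  forall M N (f : chom M N), ccomp (n N) (fmap F f) = ccomp (fmap G f) (n M).

Lemma natural_closed F G :
  funclosed (Y := fun M => chom (F M) (G M)) (@natural F G).
Proof.
split=> [M N f|c n n' hn hn' M N f].
- by apply: chom_eq => x /=; rewrite [RHS](lin0 (svalP (fmap G f)).1.1).
- rewrite [LHS]ccomp_linl [RHS]ccomp_linr; congr (_ *: _ + _).
  + exact: hn.
  + exact: hn'.
Qed.

Definition Nat F G : lmodType k := funsub (natural_closed F G).

Lemma Nat_eq F G (n n' : Nat F G) : (forall M x, n $ M $ x = n' $ M $ x) -> n = n'.
Proof. by move=> e; apply: funsub_eq => M; apply: chom_eq. Qed.

Definition nat_id F : Nat F F.
Proof. by exists (fun M => cid_hom (F M)) => M N f; apply: chom_eq. Defined.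

Definition nat_comp F G H (n' : Nat G H) (n : Nat F G) : Nat F H.
Proof.
exists (fun M => ccomp (n' $ M) (n $ M)) => M N f; apply: chom_eq => x /=.
have := congr1 (fun h => h $ x) (svalP n M N f) => /= ->.
exact: (congr1 (fun h => h $ (n $ M $ x)) (svalP n' M N f)).
Defined.

End Nat.

Record morita_context (k : comPzRingType) (R S P Q : lmodType k) := MoritaContext {
  mc_R : kalgebra_on R;
  mc_S : kalgebra_on S;
  mc_P : bimod (KAlgebra mc_R) (KAlgebra mc_S) P;
  mc_Q : bimod (KAlgebra mc_S) (KAlgebra mc_R) Q;
  mc_bul : tens mc_Q mc_P -> S;
  mc_loz : tens mc_P mc_Q -> R;
  mc_bul_bihom : bihom (tens_b mc_Q mc_P) (reg_bm (KAlgebra mc_S)) mc_bul;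
  mc_loz_bihom : bihom (tens_b mc_P mc_Q) (reg_bm (KAlgebra mc_R)) mc_loz;
  mc_assocQ : forall q p q',
    lact mc_Q (mc_bul (q ⊗ p)) q' = ract mc_Q q (mc_loz (p ⊗ q'));
  mc_assocP : forall p q p',
    lact mc_P (mc_loz (p ⊗ q)) p' = ract mc_P p (mc_bul (q ⊗ p')) }.

Arguments mc_bul {k R S P Q} m t.
Arguments mc_loz {k R S P Q} m t.

Record alg_iso (k : comPzRingType) (V W : lmodType k) (a : kalgebra_on V)
    (b : kalgebra_on W) (f : V -> W) : Prop := AlgIso {
  ai_lin : linear f;
  ai_bij : bijective f;
  ai_mul : forall x y, f (kmul a x y) = kmul b (f x) (f y);
  ai_one : f (kone a) = kone b }.

Record morita_iso (k : comPzRingType) (R S P Q R' S' P' Q' : lmodType k)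
    (M : morita_context R S P Q) (M' : morita_context R' S' P' Q')
    (a1 : R -> R') (a2 : S -> S') (a3 : P -> P') (a4 : Q -> Q') : Prop := MoritaIso {
  mi_R : alg_iso (mc_R M) (mc_R M') a1;
  mi_S : alg_iso (mc_S M) (mc_S M') a2;
  mi_P : [/\ linear a3, bijective a3,
    forall v p, a3 (lact (mc_P M) v p) = lact (mc_P M') (a1 v) (a3 p)
    & forall p u, a3 (ract (mc_P M) p u) = ract (mc_P M') (a3 p) (a2 u)];
  mi_Q : [/\ linear a4, bijective a4,
    forall u q, a4 (lact (mc_Q M) u q) = lact (mc_Q M') (a2 u) (a4 q)
    & forall q v, a4 (ract (mc_Q M) q v) = ract (mc_Q M') (a4 q) (a1 v)];
  mi_bul : forall q p, a2 (mc_bul M (q ⊗ p)) = mc_bul M' (a4 q ⊗ a3 p);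
  mi_loz : forall p q, a1 (mc_loz M (p ⊗ q)) = mc_loz M' (a3 p ⊗ a4 q) }.

Section NatMorita.
Variables (k : comPzRingType) (A L : kalgebra k) (C : coring A) (D : coring L).
Implicit Types F G H : functor C D.

Lemma nat_comp_linl F G H (n : Nat F G) : linear (fun n' : Nat G H => nat_comp n' n).
Proof. by move=> c n1 n2; apply: Nat_eq. Qed.

Lemma nat_comp_linr F G H (n' : Nat G H) : linear (fun n : Nat F G => nat_comp n' n).
Proof. by move=> c n1 n2; apply: Nat_eq => M x; exact: (svalP (n' $ M)).1.1. Qed.

Lemma nat_compA F G H K (n : Nat F G) (n' : Nat G H) (n2 : Nat H K) :
  nat_comp (nat_comp n2 n') n = nat_comp n2 (nat_comp n' n).
Proof. exact: Nat_eq. Qed.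

Lemma nat_comp1n F G (n : Nat F G) : nat_comp (nat_id G) n = n.
Proof. exact: Nat_eq. Qed.

Lemma nat_compn1 F G (n : Nat F G) : nat_comp n (nat_id F) = n.
Proof. exact: Nat_eq. Qed.

Definition nat_op_on F : kalgebra_on (Nat F F) :=
  @KAlgebraOn k (Nat F F) (fun n n' => nat_comp n' n) (nat_id F)
    (fun n n' n2 => nat_compA n n' n2) (fun n => nat_compn1 n)
    (fun n => nat_comp1n n)
    (fun n => nat_comp_linr n) (fun n => nat_comp_linl n).

Definition nat_op F : kalgebra k := KAlgebra (nat_op_on F).

Definition nat_bm F G : bimod (nat_op F) (nat_op G) (Nat F G) :=
  @BiMod k (nat_op F) (nat_op G) (Nat F G)
    (@LModule k (nat_op F) (Nat F G) (fun n t => nat_comp t n)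
      (fun t => nat_comp_linr t) (fun n => nat_comp_linl n)
      (fun n n' t => nat_compA n n' t) (fun t => nat_compn1 t))
    (@RModule k (nat_op G) (Nat F G) (fun t n => nat_comp n t)
      (fun n => nat_comp_linr n) (fun t => nat_comp_linl t)
      (fun t n n' => esym (nat_compA t n n')) (fun t => nat_comp1n t))
    (fun n t n' => esym (nat_compA n t n')).

Definition nat_conn F G (t : tens (nat_bm F G) (nat_bm G F)) : Nat F F :=
  \swe_(n, n' <- t) nat_comp n' n.

Lemma nat_conn_bal F G :
  balanced (nat_bm F G) (nat_bm G F) (fun n n' => nat_comp n' n : Nat F F).
Proof.
split=> [n'|n|n a n'].
- exact: nat_comp_linr.
- exact: nat_comp_linl.
- exact: Nat_eq.
Qed.

Lemma nat_conn_bihom F G :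
  bihom (tens_b (nat_bm F G) (nat_bm G F)) (reg_bm (nat_op F)) (@nat_conn F G).
Proof.
have ln := tsum_lin (nat_conn_bal F G); split=> [|a|t a].
- exact: ln.
- apply: tens_ext.
  + exact: lin_comp (lact_linr (tens_l (nat_bm F G) (nat_bm G F)) a) ln.
  + exact: lin_comp ln (lact_linr (reg_bm (nat_op F)) a).
  + move=> n n'; rewrite /= tens_lactE /nat_conn !(tsumE _ _ (nat_conn_bal F G)).
    exact: Nat_eq.
- move: t; apply: tens_ext.
  + exact: lin_comp (ract_linl (tens_r (nat_bm F G) (nat_bm G F)) a) ln.
  + exact: lin_comp ln (ract_linl (reg_bm (nat_op F)) a).
  + move=> n n'; rewrite /= tens_ractE /nat_conn !(tsumE _ _ (nat_conn_bal F G)).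
    exact: Nat_eq.
Qed.

Lemma nat_conn_assoc F G n n' n2 :
  lact (nat_bm F G) (@nat_conn F G (n ⊗ n')) n2 =
  ract (nat_bm F G) n (@nat_conn G F (n' ⊗ n2)).
Proof. by rewrite /nat_conn !(tsumE _ _ (nat_conn_bal _ _)); exact: Nat_eq. Qed.

Definition nat_morita F G : morita_context (Nat F F) (Nat G G) (Nat F G) (Nat G F) :=
  @MoritaContext k (Nat F F) (Nat G G) (Nat F G) (Nat G F)
    (nat_op_on F) (nat_op_on G) (nat_bm F G) (nat_bm G F)
    (@nat_conn G F) (@nat_conn F G) (nat_conn_bihom G F) (nat_conn_bihom F G)
    (@nat_conn_assoc G F) (@nat_conn_assoc F G).

End NatMorita.

Definition pure (k : comPzRingType) (A L : kalgebra k) (C : coring A)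
    (D : coring L) (E : coring_ext C D) :=
  forall M : comodule C, eq_preserved E M (tens_l D D).

Record bicomodule (k : comPzRingType) (L A : kalgebra k) (C : coring A) := Bicomodule {
  bi_co :> comodule C;
  bi_l : lmodule L bi_co;
  bi_comm : forall l x a,
    ract bi_co (lact bi_l l x) a = lact bi_l l (ract bi_co x a);
  bi_rho : lhom bi_l (tens_l (BiMod bi_comm) C) (rho bi_co) }.

Arguments bi_comm {k L A C} b l x a.

Section FunctorU.
Variables (k : comPzRingType) (A L : kalgebra k) (C : coring A) (D : coring L).
Variables (E : coring_ext C D) (pE : pure E).

Definition U_obj (M : comodule C) : comodule D :=
  @Comodule k L D M (ext_comod (pE M)).

Definition U_map (M N : comodule C) (f : chom M N) : chom (U_obj M) (U_obj N) :=
  exist _ (sval f) (ext_colinear (pE M) (pE N) (svalP f)).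

Lemma U_map_lin M N : linear (@U_map M N).
Proof. by move=> c f g; apply: chom_eq. Qed.

Lemma U_map_id M : U_map (cid_hom M) = cid_hom (U_obj M).
Proof. exact: chom_eq. Qed.

Lemma U_map_comp M N P (g : chom N P) (f : chom M N) :
  U_map (ccomp g f) = ccomp (U_map g) (U_map f).
Proof. exact: chom_eq. Qed.

Definition functorU : functor C D := Functor U_map_lin U_map_id U_map_comp.

End FunctorU.

Section Cofree.
Variables (k : comPzRingType) (L : kalgebra k) (VD V : lmodType k).
Variables (D : coring_on L VD) (r : rmodule L V).

Definition cofree_rho (t : tens r D) : tens (tens_r r D) D :=
  tassoci (tmap (fun x => x) (cop D) t).

Let hcop : lhom D (tens_l D D) (cop D).
Proof. exact: bihom_l (cop_bihom D). Qed.

Lemma cofree_rhoE x d :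
  cofree_rho (x ⊗ d) = tassoci (x ⊗ cop D d : tens r (tens_l D D)).
Proof. by rewrite /cofree_rho (tmapE (rhom_id r) hcop). Qed.

Lemma cofree_rhom : rhom (tens_r r D) (tens_r (tens_r r D) D) cofree_rho.
Proof.
apply: (rhom_comp (r' := tens_r r (tens_b D D))) (tassoci_rhom r D D).
exact: tmap_rhom (rhom_id r) (cop_bihom D).
Qed.

Lemma cofree_coassoc t :
  tassoc (tmap cofree_rho (fun d => d) (cofree_rho t)) =
  tmap (fun t => t) (cop D) (cofree_rho t).
Proof.
have hD := lhom_id D; have hr := cofree_rhom.
have hX := rhom_id (tens_r r D).
have hDD := lhom_id (tens_l D D).
have l1 : linear (fun t : tens (tens_r r D) D => tassoc (tmap cofree_rho (fun d => d) t)
   : tens (tens_r r D) (tens_l D D)).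
  exact: lin_comp (tmap_lin hr hD) (@tassoc_lin _ _ _ _ _ _ (tens_r r D) D D).
have l2 := tmap_lin hX hcop.
move: t; apply: tens_ext.
- exact: lin_comp hr.1 l1.
- exact: lin_comp hr.1 l2.
move=> x d; rewrite cofree_rhoE.
have hx : rhom D (tens_r r D) (fun d => x ⊗ d).
  split; first exact: (bal_r (tpure_bal r D) x).
  by move=> v a; rewrite /= tens_ractE.
pose P (t : tens D (tens_l D D)) : tens (tens_r r D) (tens_l D D) :=
  tmap (fun d => x ⊗ d) (fun y => y) t.
have lP : linear P := tmap_lin hx hDD.
have hcD : rhom D (tens_r D D) (cop D) := bihom_r (cop_bihom D).
have e1 (y : tens D D) : tassoc (tmap cofree_rho (fun d => d)
     (tassoci (x ⊗ y : tens r (tens_l D D)) : tens (tens_r r D) D)) =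
     P (tassoc (tmap (cop D) (fun d => d) y)).
  move: y; apply: tens_ext.
  - exact: lin_comp (lin_comp (bal_r (tpure_bal r (tens_l D D)) x)
      (@tassoci_lin _ _ _ _ _ _ r D D)) l1.
  - exact: lin_comp (lin_comp (tmap_lin hcD hD) (@tassoc_lin _ _ _ _ _ _ D D D)) lP.
  - move=> d1 d2; rewrite tassociE (tmapE hr hD) (tmapE hcD hD) cofree_rhoE.
    move: (cop D d1); apply: tens_ext.
    + exact: lin_comp (lin_comp (lin_comp (bal_r (tpure_bal r (tens_l D D)) x)
        (@tassoci_lin _ _ _ _ _ _ r D D)) (bal_l (tpure_bal (tens_r (tens_r r D) D) D) d2))
        (@tassoc_lin _ _ _ _ _ _ (tens_r r D) D D).
    + exact: lin_comp (lin_comp (bal_l (tpure_bal (tens_r D D) D) d2)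
        (@tassoc_lin _ _ _ _ _ _ D D D)) lP.
    + by move=> u v; rewrite tassociE !tassocE /P (tmapE hx hDD).
have e2 (y : tens D D) : tmap (fun t => t) (cop D)
     (tassoci (x ⊗ y : tens r (tens_l D D)) : tens (tens_r r D) D) =
     P (tmap (fun d => d) (cop D) y).
  move: y; apply: tens_ext.
  - exact: lin_comp (lin_comp (bal_r (tpure_bal r (tens_l D D)) x)
      (@tassoci_lin _ _ _ _ _ _ r D D)) l2.
  - exact: lin_comp (tmap_lin (rhom_id D) hcop) lP.
  - move=> d1 d2; rewrite tassociE (tmapE hX hcop) (tmapE (rhom_id D) hcop).
    by rewrite /P (tmapE hx hDD).
by rewrite e1 e2 cop_coassoc.
Qed.

Lemma cofree_counit t :
  \swe_(y, d <- cofree_rho t) ract (tens_r r D) y (cou D d) = t.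
Proof.
have [lc cl cr] := cou_bihom D.
have b : balanced (tens_r r D) D (fun y d => ract (tens_r r D) y (cou D d)).
  split.
  - by move=> d; exact: ract_linl.
  - by move=> v; exact: lin_comp lc (ract_linr (tens_r r D) v).
  - by move=> v a d; rewrite cl ractA.
move: t; apply: tens_ext.
- exact: lin_comp cofree_rhom.1 (tsum_lin b).
- exact: lin_id.
move=> x d; rewrite cofree_rhoE -[in RHS](cou_r D d).
move: (cop D d); have bD : balanced D D (fun d1 d2 => ract D d1 (cou D d2)).
  split.
  - by move=> w; exact: ract_linl.
  - by move=> v; exact: lin_comp lc (ract_linr D v).
  - by move=> v a w; rewrite cl ractA.
apply: tens_ext.
- exact: lin_comp (lin_comp (bal_r (tpure_bal r (tens_l D D)) x)
    (@tassoci_lin _ _ _ _ _ _ r D D)) (tsum_lin b).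
- exact: lin_comp (tsum_lin bD) (bal_r (tpure_bal r D) x).
- by move=> d1 d2; rewrite tassociE !tsumE //= tens_ractE.
Qed.

Definition cofree : comodule_on D (tens r D) :=
  ComoduleOn cofree_rhom cofree_coassoc cofree_counit.

End Cofree.

Lemma cofree_colinear (k : comPzRingType) (L : kalgebra k) (VD V W : lmodType k)
    (D : coring_on L VD) (r : rmodule L V) (s : rmodule L W) f :
  rhom r s f -> colinear (cofree D r) (cofree D s) (tmap f (fun d => d)).
Proof.
move=> hf; have hD := lhom_id D; have hc := bihom_l (cop_bihom D).
have hm : rhom (tens_r r D) (tens_r s D) (tmap f (fun d => d)).
  exact: tmap_rhom hf (bihom_id D).
split=> //; apply: tens_ext.
- exact: lin_comp (tmap_lin hf hD) (cofree_rhom D s).1.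
- exact: lin_comp (cofree_rhom D r).1 (tmap_lin hm hD).
move=> x d; rewrite (tmapE hf hD) /= !cofree_rhoE.
move: (cop D d); apply: tens_ext.
- exact: lin_comp (bal_r (tpure_bal s (tens_l D D)) (f x)) (@tassoci_lin _ _ _ _ _ _ s D D).
- exact: lin_comp (lin_comp (bal_r (tpure_bal r (tens_l D D)) x)
    (@tassoci_lin _ _ _ _ _ _ r D D)) (tmap_lin hm hD).
- by move=> d1 d2; rewrite !tassociE (tmapE hm hD) (tmapE hf hD).
Qed.

Section Sigma.
Variables (k : comPzRingType) (A L : kalgebra k) (C : coring A) (D : coring L).
Variable Sg : bicomodule L C.

Definition bi_bm : bimod L A Sg := BiMod (bi_comm Sg).

Lemma bi_lact_colinear l : colinear Sg Sg (lact (bi_l Sg) l).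
Proof.
split; first by split; [exact: lact_linr | move=> v a; rewrite bi_comm].
exact: (bi_rho Sg).2.
Qed.

Definition bi_lact (l : L) : chom Sg Sg := exist _ _ (bi_lact_colinear l).

Definition hom_ract (M : comodule C) (phi : chom Sg M) (l : L) : chom Sg M :=
  ccomp phi (bi_lact l).

Lemma hom_ract_linl M l : linear ((@hom_ract M)^~ l).
Proof. exact: ccomp_linl. Qed.
Lemma hom_ract_linr M phi : linear (@hom_ract M phi).
Proof.
move=> c l l'; apply: chom_eq => x /=.
by rewrite (lact_linl (bi_l Sg)) (svalP phi).1.1.
Qed.
Lemma hom_ractA M (phi : chom Sg M) l l' :
  hom_ract (hom_ract phi l) l' = hom_ract phi (kmul L l l').
Proof. by apply: chom_eq => x /=; rewrite lactA. Qed.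
Lemma hom_ract1 M (phi : chom Sg M) : hom_ract phi (kone L) = phi.
Proof. by apply: chom_eq => x /=; rewrite lact1. Qed.

Definition hom_rmod (M : comodule C) : rmodule L (chom Sg M) :=
  @RModule k L (chom Sg M) (@hom_ract M) (@hom_ract_linl M) (@hom_ract_linr M)
    (@hom_ractA M) (@hom_ract1 M).

Definition End_lact (l : L) (t : chom Sg Sg) : chom Sg Sg := ccomp (bi_lact l) t.

Lemma End_lact_linl t : linear (End_lact^~ t).
Proof. by move=> c l l'; apply: chom_eq => x /=; exact: (lact_linl (bi_l Sg)). Qed.
Lemma End_lact_linr l : linear (End_lact l).
Proof. exact: ccomp_linr. Qed.
Lemma End_lactA l l' t : End_lact l (End_lact l' t) = End_lact (kmul L l l') t.
Proof. by apply: chom_eq => x /=; rewrite lactA. Qed.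
Lemma End_lact1 t : End_lact (kone L) t = t.
Proof. by apply: chom_eq => x /=; rewrite lact1. Qed.
Lemma End_comm l t l' :
  ract (hom_rmod Sg) (End_lact l t) l' = End_lact l (ract (hom_rmod Sg) t l').
Proof. exact: chom_eq. Qed.

Definition End_bm : bimod L L (chom Sg Sg) :=
  @BiMod k L L (chom Sg Sg)
    (@LModule k L (chom Sg Sg) End_lact End_lact_linl End_lact_linr End_lactA
      End_lact1)
    (hom_rmod Sg) End_comm.

Definition dual : lmodType k := funsub (rhom_closed Sg (reg_bm A)).

Definition dual_lact (a : A) (xi : dual) : dual.
Proof.
exists (fun x => kmul A a (xi $ x)).
have [lx rx] := svalP xi; split; first exact: lin_comp lx (kmul_linr A a).
by move=> x b; rewrite rx /= kmulA.
Defined.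

Definition dual_ract (xi : dual) (l : L) : dual.
Proof.
exists (fun x => xi $ lact (bi_l Sg) l x).
have [lx rx] := svalP xi; split; first exact: lin_comp (lact_linr (bi_l Sg) l) lx.
by move=> x b; rewrite -bi_comm rx.
Defined.

Lemma dual_lact_linl xi : linear (dual_lact^~ xi).
Proof. by move=> c a b; apply: funsub_eq => x; exact: (kmul_linl A). Qed.
Lemma dual_lact_linr a : linear (dual_lact a).
Proof. by move=> c xi xi'; apply: funsub_eq => x; exact: (kmul_linr A). Qed.
Lemma dual_lactA a b xi : dual_lact a (dual_lact b xi) = dual_lact (kmul A a b) xi.
Proof. by apply: funsub_eq => x /=; rewrite kmulA. Qed.
Lemma dual_lact1 xi : dual_lact (kone A) xi = xi.
Proof. by apply: funsub_eq => x /=; rewrite kmul1l. Qed.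
Lemma dual_ract_linl l : linear (dual_ract^~ l).
Proof. by move=> c xi xi'; apply: funsub_eq. Qed.
Lemma dual_ract_linr xi : linear (dual_ract xi).
Proof.
move=> c l l'; apply: funsub_eq => x /=.
by rewrite (lact_linl (bi_l Sg)) (svalP xi).1.
Qed.
Lemma dual_ractA xi l l' : dual_ract (dual_ract xi l) l' = dual_ract xi (kmul L l l').
Proof. by apply: funsub_eq => x /=; rewrite lactA. Qed.
Lemma dual_ract1 xi : dual_ract xi (kone L) = xi.
Proof. by apply: funsub_eq => x /=; rewrite lact1. Qed.
Lemma dual_comm a xi l : dual_ract (dual_lact a xi) l = dual_lact a (dual_ract xi l).
Proof. exact: funsub_eq. Qed.

Definition dual_bm : bimod A L dual :=
  @BiMod k A L dual
    (LModule dual_lact_linl dual_lact_linr dual_lactA dual_lact1)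
    (RModule dual_ract_linl dual_ract_linr dual_ractA dual_ract1)
    dual_comm.

Definition V_obj (M : comodule C) : comodule D :=
  @Comodule k L D (ktens (hom_rmod M) D) (cofree D (hom_rmod M)).

Lemma V_map_rhom (M N : comodule C) (f : chom M N) :
  rhom (hom_rmod M) (hom_rmod N) (fun phi => ccomp f phi).
Proof. by split; [exact: ccomp_linr | move=> phi l; exact: chom_eq]. Qed.

Definition V_map (M N : comodule C) (f : chom M N) : chom (V_obj M) (V_obj N) :=
  exist _ _ (cofree_colinear D (V_map_rhom f)).

Lemma V_map_lin M N : linear (@V_map M N).
Proof.
move=> c f g; apply: chom_eq => t /=.
apply: etrans (tmap_lin_f (hom_rmod N) D c _ _ _ t).
by apply: tmap_ext => // phi; exact: ccomp_linl.
Qed.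

Lemma V_map_id M : V_map (cid_hom M) = cid_hom (V_obj M).
Proof.
apply: chom_eq => t /=; apply: etrans _ (tmap_id t).
by apply: tmap_ext => // phi; exact: chom_eq.
Qed.

Lemma V_map_comp M N P (g : chom N P) (f : chom M N) :
  V_map (ccomp g f) = ccomp (V_map g) (V_map f).
Proof.
apply: chom_eq => t /=.
apply: etrans _ (esym (tmap_comp _ _ t (V_map_rhom g) (lhom_id D))).
by apply: tmap_ext => // phi; exact: chom_eq.
Qed.

Definition functorV : functor C D := Functor V_map_lin V_map_id V_map_comp.

End Sigma.

Section Tilde.
Variables (k : comPzRingType) (A L : kalgebra k) (C : coring A) (D : coring L).
Variables (E : coring_ext C D) (pE : pure E) (Sg : bicomodule L C).

Definition homLL : lmodType k := funsub (bihom_closed D (End_bm Sg)).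

Definition lcolinear (u : C -> C) :=
  lhom C C u /\ forall c, cop C (u c) = tmap (fun x => x) u (cop C c).

Lemma endCD_closed : funclosed (fun u : C -> C => lcolinear u /\ colinear E E u).
Proof.
have [l0 lD] := lhom_closed C C; have [r0 rD] := colinear_closed E E.
have lc : linear (cop C) by case: (cop_bihom C).
split=> [|c f g [[hf cf] rf] [[hg cg] rg]]; (split; [split|]) => //.
- move=> x; rewrite (lin0 lc) /tmap /tsum big1 // => p _.
  exact: (lin0 (bal_r (tpure_bal C C) _)).
- exact: lD.
- move=> x; rewrite lc cf cg /tmap /tsum scaler_sumr -big_split /=.
  by apply: eq_bigr => p _; rewrite (bal_r (tpure_bal C C)).
- exact: rD.
Qed.

Definition endCD : lmodType k := funsub endCD_closed.

Lemma homLD_closed : funclosed (fun p : D -> Sg =>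
  lhom D (bi_l Sg) p /\ colinear (reg_co D) (U_obj pE Sg) p).
Proof.
have [l0 lD] := lhom_closed D (bi_l Sg).
have [r0 rD] := colinear_closed (reg_co D) (U_obj pE Sg).
by split=> [|c f g [hf cf] [hg cg]]; split=> //; [exact: lD | exact: rD].
Qed.

Definition homLD : lmodType k := funsub homLD_closed.

Lemma Qtilde_closed : funclosed (fun q : C -> dual Sg =>
  bihom (ext_bm E) (dual_bm Sg) q /\
  forall x c, \swe_(c1, c2 <- cop C c) ract C c1 (q c2 $ x) =
              \swe_(x0, x1 <- rho Sg x) lact C (q c $ x0) x1).
Proof.
have [l0 lD] := bihom_closed (ext_bm E) (dual_bm Sg).
split=> [|c f g [hf cf] [hg cg]]; split=> //.
- move=> x c; rewrite /tsum !big1 // => p _.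
  + exact: (lin0 (lact_linl C _)).
  + exact: (lin0 (ract_linr C _)).
- exact: lD.
- move=> x d.
  transitivity (c *: (\swe_(c1, c2 <- cop C d) ract C c1 (f c2 $ x)) +
                \swe_(c1, c2 <- cop C d) ract C c1 (g c2 $ x)).
    rewrite /tsum scaler_sumr -big_split /=; apply: eq_bigr => p _.
    exact: (ract_linr C).
  rewrite cf cg /tsum scaler_sumr -big_split /=; apply: eq_bigr => p _.
  by rewrite -(lact_linl C).
Qed.

Definition Qtilde : lmodType k := funsub Qtilde_closed.

End Tilde.

(* Main.v *)
Require Import Defs.
From mathcomp Require Import all_boot all_algebra.

Set Implicit Arguments.
Unset Strict Implicit.
Unset Printing Implicit Defensive.

Import GRing.Theory.
Local Open Scope ring_scope.

(** The four isomorphisms are two Yoneda arguments, and the Morita context is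
    read off from them.

    Transformations out of V.  The comodule V(M) = Hom(Sigma, M) ⊗ D is generated
    by the images of the elements id ⊗ d of V(Sigma), so a natural transformation
    from V to G amounts to a right D-colinear map D -> G(Sigma) which is left
    L-linear ([yoneda], [coyonedaK]).  For G = U this is an element of
    Hom_L^D(D, Sigma), which gives alpha_3.  For G = V the target T ⊗ D is cofree,
    so colinear maps into it are L-linear maps into T, which gives alpha_1.

    Transformations out of U.  A family of linear maps theta_M : M -> M, natural in
    the C-comodule M, is determined by the form w = eps theta_C on C, through
    theta_M(m) = m0 w(m1): naturality along the coaction M -> M ⊗ C and along the
    maps c |-> x ⊗ c gives rho(theta_M(m)) = m0 ⊗ theta_C(m1), to which M ⊗ eps is
    applied ([rho_natural], [natural_coact]).  For transformations from U to U this
    says that the member at C, which is left C-colinear, determines the others;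
    this is alpha_2.  As V(M) is cofree, a transformation from U to V is a natural
    family of right L-linear maps M -> Hom(Sigma, M); evaluated at each x in Sigma
    it is of the kind above, so it has the form m |-> m0 q(m1)(x), and that these
    maps be colinear in x is exactly the condition defining Q-tilde.  This is
    alpha_4.  Conversely, that m |-> m0 eps(u(m1)) is D-colinear for the coactions
    tau_M is checked after embedding M ⊗_L D into M ⊗_A C ⊗_L D, which is possible
    by purity ([coact_endCD_colinear]).

    The Morita context.  Pulling the structure of the context of natural
    transformations back along these bijections yields a Morita context
    isomorphic to it ([transport_morita]), with no axiom left to verify.  Its
    operations are computed by evaluating composites of natural transformations
    at id ⊗ d or at C. *)

(** * Transport of a Morita context *)

(** Linearity is demanded of the inverse because the isomorphisms below have an
    inverse given by evaluation at one object, which is visibly linear. *)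
Record kiso (k : comPzRingType) (V W : lmodType k) := KIso {
  fwd :> V -> W;
  bwd : W -> V;
  bwd_lin : linear bwd;
  fwdK : cancel fwd bwd;
  bwdK : cancel bwd fwd }.

Section Transport.
Variable k : comPzRingType.

Lemma fwd_lin (V W : lmodType k) (f : kiso V W) : linear f.
Proof. by move=> c x y; apply: (can_inj (bwdK f)); rewrite bwd_lin !fwdK. Qed.

Lemma fwd_bij (V W : lmodType k) (f : kiso V W) : bijective f.
Proof. by exists (bwd f); [exact: fwdK | exact: bwdK]. Qed.

Definition transport_alg (V W : lmodType k) (f : kiso V W) (a : kalgebra_on W) :
  kalgebra_on V.
Proof.
refine (@KAlgebraOn k V (fun x y => bwd f (kmul a (f x) (f y))) (bwd f (kone a))
  _ _ _ _ _).
- by move=> x y z; rewrite !bwdK kmulA.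
- by move=> x; rewrite bwdK kmul1l fwdK.
- by move=> x; rewrite bwdK kmul1r fwdK.
- by move=> y c x x'; rewrite fwd_lin (kmul_linl a) bwd_lin.
- by move=> x c y y'; rewrite fwd_lin (kmul_linr a) bwd_lin.
Defined.

Lemma transport_alg_iso (V W : lmodType k) (f : kiso V W) (a : kalgebra_on W) :
  alg_iso (transport_alg f a) a f.
Proof.
split; [exact: fwd_lin | exact: fwd_bij | |] => *; exact: bwdK.
Qed.

Definition transport_bimod (R S P R' S' P' : lmodType k) (f : kiso R R')
    (g : kiso S S') (h : kiso P P') (a : kalgebra_on R') (b : kalgebra_on S')
    (m : bimod (KAlgebra a) (KAlgebra b) P') :
  bimod (KAlgebra (transport_alg f a)) (KAlgebra (transport_alg g b)) P.
Proof.
unshelve refine (@BiMod k _ _ P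
  (@LModule k (KAlgebra (transport_alg f a)) P
     (fun r x => bwd h (lact m (f r) (h x))) _ _ _ _)
  (@RModule k (KAlgebra (transport_alg g b)) P
     (fun x s => bwd h (ract m (h x) (g s))) _ _ _ _) _).
- by move=> x c r r'; rewrite fwd_lin (lact_linl m) bwd_lin.
- by move=> r c x x'; rewrite fwd_lin (lact_linr m) bwd_lin.
- by move=> r r' x; rewrite /= !bwdK lactA.
- by move=> x; rewrite /= bwdK (lact1 m) fwdK.
- by move=> s c x x'; rewrite fwd_lin (ract_linl m) bwd_lin.
- by move=> x c s s'; rewrite fwd_lin (ract_linr m) bwd_lin.
- by move=> x s s'; rewrite /= !bwdK ractA.
- by move=> x; rewrite /= bwdK (ract1 m) fwdK.
- by move=> r x s; rewrite /= !bwdK bm_comm.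
Defined.

Section TransportConn.
Variables (R S P Q R' S' P' Q' : lmodType k).
Variables (a1 : kiso R R') (a2 : kiso S S') (a3 : kiso P P') (a4 : kiso Q Q').
Variables (a : kalgebra_on R') (b : kalgebra_on S').
Variables (p : bimod (KAlgebra a) (KAlgebra b) P').
Variables (q : bimod (KAlgebra b) (KAlgebra a) Q').
Variable conn : tens q p -> S'.
Hypothesis hc : bihom (tens_b q p) (reg_bm (KAlgebra b)) conn.
Let p0 := transport_bimod a1 a2 a3 p.
Let q0 := transport_bimod a2 a1 a4 q.

Definition transport_conn (t : tens q0 p0) : S :=
  \swe_(y, x <- t) bwd a2 (conn (a4 y ⊗ a3 x)).

Lemma transport_conn_bal : balanced q0 p0 (fun y x => bwd a2 (conn (a4 y ⊗ a3 x))).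
Proof.
have [lc _ _] := hc; split.
- move=> x; apply: lin_comp (bwd_lin a2); apply: lin_comp lc.
  exact: lin_comp (fwd_lin a4) (bal_l (tpure_bal q p) _).
- move=> y; apply: lin_comp (bwd_lin a2); apply: lin_comp lc.
  exact: lin_comp (fwd_lin a3) (bal_r (tpure_bal q p) _).
- by move=> y r x; rewrite /= !bwdK (bal_m (tpure_bal q p)).
Qed.

Lemma transport_connE y x : transport_conn (y ⊗ x) = bwd a2 (conn (a4 y ⊗ a3 x)).
Proof. exact: tsumE transport_conn_bal. Qed.

Lemma transport_conn_bihom :
  bihom (tens_b q0 p0) (reg_bm (KAlgebra (transport_alg a2 b))) transport_conn.
Proof.
have [lc cl cr] := hc; have lt := tsum_lin transport_conn_bal.
split=> [|s|t s]; first exact: lt.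
- apply: tens_ext.
  + exact: lin_comp (lact_linr (tens_l q0 p0) s) lt.
  + exact: lin_comp lt (kmul_linr (transport_alg a2 b) s).
  + move=> y x; rewrite /= tens_lactE !transport_connE /= !bwdK.
    by have /= <- := cl (a2 s) (a4 y ⊗ a3 x); rewrite tens_lactE.
- move: t; apply: tens_ext.
  + exact: lin_comp (ract_linl (tens_r q0 p0) s) lt.
  + exact: lin_comp lt (kmul_linl (transport_alg a2 b) s).
  + move=> y x; rewrite /= tens_ractE !transport_connE /= !bwdK.
    by have /= <- := cr (a4 y ⊗ a3 x) (a2 s); rewrite tens_ractE.
Qed.

End TransportConn.

Section TransportMorita.
Variables (R S P Q R' S' P' Q' : lmodType k) (M : morita_context R' S' P' Q').
Variables (a1 : kiso R R') (a2 : kiso S S') (a3 : kiso P P') (a4 : kiso Q Q').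

(** Pulling the whole structure back along four linear bijections makes every
    axiom of a Morita context inherited and the bijections an isomorphism by
    construction; what remains to be done for a given context is to compute the
    structure maps. *)
Definition transport_morita : morita_context R S P Q.
Proof.
refine (@MoritaContext k R S P Q (transport_alg a1 (mc_R M))
  (transport_alg a2 (mc_S M)) (transport_bimod a1 a2 a3 (mc_P M))
  (transport_bimod a2 a1 a4 (mc_Q M)) _ _
  (transport_conn_bihom a1 a2 a3 a4 (mc_bul_bihom M))
  (transport_conn_bihom a2 a1 a4 a3 (mc_loz_bihom M)) _ _).
- move=> q p q'; rewrite !transport_connE; try exact: mc_loz_bihom; try exact: mc_bul_bihom.
  by rewrite /= !bwdK mc_assocQ.
- move=> p q p'; rewrite !transport_connE; try exact: mc_loz_bihom; try exact: mc_bul_bihom.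
  by rewrite /= !bwdK mc_assocP.
Defined.

Lemma transport_bulE q p :
  mc_bul transport_morita (q ⊗ p) = bwd a2 (mc_bul M (a4 q ⊗ a3 p)).
Proof. exact: transport_connE (mc_bul_bihom M) _ _. Qed.

Lemma transport_lozE p q :
  mc_loz transport_morita (p ⊗ q) = bwd a1 (mc_loz M (a3 p ⊗ a4 q)).
Proof. exact: transport_connE (mc_loz_bihom M) _ _. Qed.

Lemma transport_morita_iso : morita_iso transport_morita M a1 a2 a3 a4.
Proof.
split.
- exact: transport_alg_iso.
- exact: transport_alg_iso.
- split; [exact: fwd_lin | exact: fwd_bij | |] => *; exact: bwdK.
- split; [exact: fwd_lin | exact: fwd_bij | |] => *; exact: bwdK.
- by move=> q p; rewrite transport_bulE bwdK.
- by move=> p q; rewrite transport_lozE bwdK.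
Qed.

End TransportMorita.
End Transport.

(** * Cofree comodules *)

Section CofreeUniversal.
Variables (k : comPzRingType) (L : kalgebra k) (D : coring L).

Section Counit.
Variables (X : lmodType k) (r : rmodule L X).

(** X ⊗ eps, the universal map from the cofree comodule on X to X: composition
    with it identifies colinear maps into X ⊗ D with L-linear maps into X
    ([ceps_cofree_of], [cofree_colinearE]). *)
Definition ceps (t : tens r D) : X := \swe_(x, d <- t) ract r x (cou D d).

Lemma ceps_bal : balanced r D (fun x d => ract r x (cou D d)).
Proof.
have [lc cl cr] := cou_bihom D; split.
- by move=> d; exact: ract_linl.
- by move=> x; exact: lin_comp lc (ract_linr r x).
- by move=> x a d; rewrite cl ractA.
Qed.

Lemma cepsE x d : ceps (x ⊗ d) = ract r x (cou D d).
Proof. exact: tsumE ceps_bal. Qed.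

Lemma ceps_rhom : rhom (tens_r r D) r ceps.
Proof.
have [lc cl cr] := cou_bihom D; have le := tsum_lin ceps_bal.
split=> // t l; move: t; apply: tens_ext.
- exact: lin_comp (ract_linl (tens_r r D) l) le.
- exact: lin_comp le (ract_linl r l).
- by move=> x d; rewrite /= tens_ractE !cepsE cr ractA.
Qed.

(** The counit law eps(d1) d2 = d, tensored with X.  This is what recovers a
    colinear map f into X ⊗ D from its composite with X ⊗ eps, because the
    coaction applied to f(m) is f(m0) ⊗ m1. *)
Lemma cofree_ceps (t : tens r D) :
  tmap ceps (fun d => d) (cofree_rho t) = t :> tens r D.
Proof.
have [lc cl cr] := cou_bihom D.
have hD := lhom_id D; have hc := ceps_rhom.
pose e (y : tens D D) := \swe_(d1, d2 <- y) lact D (cou D d1) d2.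
have be : balanced D D (fun d1 d2 => lact D (cou D d1) d2).
  split.
  - by move=> d; exact: lin_comp lc (lact_linl D d).
  - by move=> d; exact: lact_linr.
  - by move=> d a d'; rewrite cr lactA.
move: t; apply: tens_ext => [||x d].
- exact: lin_comp (cofree_rhom D r).1 (tmap_lin hc hD).
- exact: lin_id.
- rewrite cofree_rhoE -[in RHS](cou_l D d) -/(e _).
  move: (cop D d); apply: tens_ext.
  + exact: lin_comp (lin_comp (bal_r (tpure_bal r (tens_l D D)) x)
      (@tassoci_lin _ _ _ _ _ _ r D D)) (tmap_lin hc hD).
  + exact: lin_comp (tsum_lin be) (bal_r (tpure_bal r D) x).
  + move=> d1 d2; rewrite tassociE (tmapE hc hD) cepsE /e tsumE //.
    by rewrite (bal_m (tpure_bal r D)).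
Qed.

(** One of the two families of colinear maps on which naturality will be tested;
    the other is the coaction, in [rho_colinear]. *)
Lemma tpure_colinear x :
  colinear (reg_co D) (cofree D r) (tpure r D x).
Proof.
have hx : rhom D (tens_r r D) (tpure r D x).
  split; first exact: (bal_r (tpure_bal r D) x).
  by move=> d l; rewrite /= tens_ractE.
split=> // d; rewrite /= cofree_rhoE.
move: (cop D d); apply: tens_ext => [||d1 d2].
- exact: lin_comp (bal_r (tpure_bal r (tens_l D D)) x)
    (@tassoci_lin _ _ _ _ _ _ r D D).
- exact: tmap_lin hx (lhom_id D).
- by rewrite tassociE (tmapE hx (lhom_id D)).
Qed.

End Counit.

Section Maps.
Variables (W X : lmodType k) (N : comodule_on D W) (r : rmodule L X).

(** This is coassociativity. *)
Lemma rho_colinear : colinear N (cofree D N) (rho N).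
Proof.
split=> [|m]; first exact: rho_rhom.
rewrite /= /cofree_rho -(rho_coassoc N m).
by rewrite tassocK.
Qed.

Lemma cofree_of_colinear (g : W -> X) : rhom N r g ->
  colinear N (cofree D r) (fun m => tmap g (fun d => d) (rho N m)).
Proof. by move=> hg; exact: colinear_comp rho_colinear (cofree_colinear D hg). Qed.

Lemma ceps_cofree_of (g : W -> X) m : rhom N r g ->
  ceps (tmap g (fun d => d) (rho N m) : tens r D) = g m.
Proof.
move=> [lg hg]; rewrite /ceps tsum_tmap; last exact: ceps_bal.
rewrite -[in RHS](rho_counit N m) (lin_tsum _ _ lg).
by apply: tsum_ext => x d; rewrite hg.
Qed.

Lemma cofree_colinearE (f : W -> tens r D) m : colinear N (cofree D r) f ->
  f m = tmap (fun x => ceps (f x)) (fun d => d) (rho N m).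
Proof.
move=> [hf cf]; rewrite -[LHS]cofree_ceps.
have /= -> := cf m.
by rewrite (tmap_comp _ _ _ (ceps_rhom r) (lhom_id D)).
Qed.

End Maps.
End CofreeUniversal.

(** * The action of the left dual of a coring on comodules *)

Section Coact.
Variables (k : comPzRingType) (A : kalgebra k) (C : coring A).

Section OneComodule.
Variables (w : C -> A) (V : lmodType k) (M : comodule_on C V).

(** A left A-linear form w on C acts on all right comodules by m |-> m0 w(m1); this
    is the action of the left dual ring of C.  The actions of L, of the left and
    right colinear endomorphisms of C, and of the elements of Q-tilde are all
    instances. *)
Definition coact (m : V) : V := \swe_(m0, m1 <- rho M m) ract M m0 (w m1).

Hypothesis hw : lhom C (reg_bm A) w.

Lemma coact_bal : balanced M C (fun m0 m1 => ract M m0 (w m1)).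
Proof.
have [lw aw] := hw; split.
- by move=> c; exact: ract_linl.
- by move=> m; exact: lin_comp lw (ract_linr M m).
- by move=> m a c; rewrite aw ractA.
Qed.

Lemma coact_lin : linear coact.
Proof. exact: lin_comp (rho_rhom M).1 (tsum_lin coact_bal). Qed.

End OneComodule.

Lemma coact_nat w (V W : lmodType k) (M : comodule_on C V) (N : comodule_on C W)
    f m : lhom C (reg_bm A) w -> colinear M N f ->
  f (coact w M m) = coact w N (f m).
Proof.
move=> hw [[lf fr] fc].
rewrite /coact (lin_tsum _ _ lf) fc tsum_tmap; last exact: coact_bal.
by apply: tsum_ext => x c; rewrite fr.
Qed.

Section LeftColinear.
Variable w : C -> A.
Hypothesis hw : lhom C (reg_bm A) w.
Local Notation wC := (coact w (reg_co C)).

Lemma coact_lhom : lhom C C wC.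
Proof.
have lc := coact_lin (reg_co C) hw.
split=> // a c; rewrite /coact /=.
have [_ cl _] := cop_bihom C; rewrite cl.
move: (cop C c) => y; rewrite /= /tens_lact tsum_tmap; last exact: (coact_bal (reg_co C) hw).
rewrite (lin_tsum _ _ (lact_linr C a)).
by apply: tsum_ext => c1 c2; rewrite bm_comm.
Qed.

(** Naturality of the action of w, applied to the colinear map rho, moves the
    action to M ⊗ C; there it is computed by naturality along the colinear maps
    c |-> x ⊗ c, and so takes place on the factor C only.  Taking M = C gives
    the left C-colinearity of the action of w on C. *)
Lemma rho_coact (V : lmodType k) (M : comodule_on C V) m :
  rho M (coact w M m) = tmap (fun x => x) wC (rho M m).
Proof.
rewrite (coact_nat m hw (rho_colinear M)).
move: (rho M m); apply: tens_ext => [||x c].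
- exact: coact_lin.
- exact: tmap_lin (rhom_id M) coact_lhom.
- rewrite (tmapE (rhom_id M) coact_lhom).
  exact: esym (coact_nat c hw (tpure_colinear C M x)).
Qed.

Lemma cou_coact c : cou C (wC c) = w c.
Proof.
have [lc cl cr] := cou_bihom C; have [lw aw] := hw.
rewrite /coact (lin_tsum _ _ lc) -[in RHS](cou_l C c) (lin_tsum _ _ lw).
by apply: tsum_ext => c1 c2; rewrite cr aw.
Qed.

End LeftColinear.
End Coact.

Definition coreg (k : comPzRingType) (A : kalgebra k) (C : coring A) : comodule C :=
  Comodule (reg_co C).

Lemma cou_lhom (k : comPzRingType) (A : kalgebra k) (C : coring A) : lhom C (reg_bm A) (cou C).
Proof. exact: bihom_l (cou_bihom C). Qed.

(** A natural family of linear endomaps of the underlying modules of all comodules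
    is the action of a unique form on C, namely of eps composed with its member
    at C.  This is what reduces natural transformations starting at U to maps
    defined on C. *)
Section NaturalFamily.
Variables (k : comPzRingType) (A : kalgebra k) (C : coring A).
Variable th : forall M : comodule C, M -> M.
Hypothesis th_lin : forall M, linear (@th M).
Hypothesis th_nat :
  forall (M N : comodule C) (f : M -> N) m, colinear M N f -> th (f m) = f (th m).
Local Notation thC := (@th (coreg C)).

(** Left multiplication by a is colinear on C. *)
Lemma natural_lhom : lhom C C thC.
Proof.
split=> [|a c]; first exact: (@th_lin (coreg C)).
apply: (th_nat (M := coreg C) (N := coreg C)); split.
  by split=> [|c' b]; [exact: lact_linr | rewrite /= bm_comm].
by have [_ cl _] := cop_bihom C; exact: cl.
Qed.

(** The argument of [rho_coact]: naturality along rho : M -> M ⊗ C, then along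
    c |-> x ⊗ c. *)
Lemma rho_natural (M : comodule C) (m : M) :
  rho M (th m) = tmap (fun x => x) thC (rho M m).
Proof.
pose F : comodule C := Comodule (co_mod := ktens M C) (cofree C M).
rewrite -(th_nat (N := F) m (rho_colinear M)).
move: (rho M m); apply: (tens_ext (F := @th F)) => [||x c].
- exact: (@th_lin F).
- exact: tmap_lin (rhom_id M) natural_lhom.
- rewrite (tmapE (rhom_id M) natural_lhom).
  exact: (th_nat (M := coreg C) (N := F) c (tpure_colinear C M x)).
Qed.

Lemma cou_natural_lhom : lhom C (reg_bm A) (fun c => cou C (thC c)).
Proof. exact: lhom_comp natural_lhom (cou_lhom C). Qed.

Lemma natural_coact (M : comodule C) (m : M) :
  th m = coact (fun c => cou C (thC c)) M m.
Proof.
rewrite -[LHS](rho_counit M) rho_natural tsum_tmap //.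
exact: coact_bal (cou_lhom C).
Qed.

End NaturalFamily.

(** * Natural transformations out of V *)

(** V(M) is generated by the images V(phi)(id ⊗ d), for phi : Sigma -> M, so a
    natural transformation from V to G is determined by the map d |-> n(id ⊗ d)
    from D to G(Sigma).  That map is right D-colinear, and it is left L-linear
    when L acts on G(Sigma) through its action on Sigma by colinear maps;
    [yoneda] and [coyoneda] show that nothing else is required of it. *)
Section Yoneda.
Variables (k : comPzRingType) (A L : kalgebra k) (C : coring A) (D : coring L).
Variables (Sg : bicomodule L C) (G : functor C D).
Local Notation V := (functorV D Sg).

Section OfElement.
Variable f : D -> G Sg.
Hypothesis hf : colinear (reg_co D) (G Sg) f.
Hypothesis lf : forall l d, f (lact D l d) = fmap G (bi_lact Sg l) $ (f d).

Definition yoneda_fun (M : comodule C) (t : V M) : G M :=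
  tsum (t : tens (hom_rmod Sg M) D) (fun phi d => fmap G phi $ (f d)).

Lemma yoneda_bal (M : comodule C) :
  balanced (hom_rmod Sg M) D (fun phi d => fmap G phi $ (f d) : G M).
Proof.
split.
- by move=> d c phi psi; rewrite fmap_lin.
- by move=> phi; exact: lin_comp hf.1.1 (svalP (fmap G phi)).1.1.
- by move=> phi l d; rewrite lf /= /hom_ract fmap_comp.
Qed.

Lemma yoneda_funE (M : comodule C) (phi : chom Sg M) d :
  yoneda_fun (phi ⊗ d : tens (hom_rmod Sg M) D) = fmap G phi $ (f d).
Proof. exact: (tsumE phi d (yoneda_bal M)). Qed.

Lemma yoneda_colinear (M : comodule C) : colinear (V M) (G M) (@yoneda_fun M).
Proof.
have ly := tsum_lin (yoneda_bal M).
have hy : rhom (tens_r (hom_rmod Sg M) D) (G M) (@yoneda_fun M).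
  split=> // t l; move: t; apply: tens_ext.
  - exact: lin_comp (ract_linl (tens_r (hom_rmod Sg M) D) l) ly.
  - exact: lin_comp ly (ract_linl (G M) l).
  - move=> phi d; rewrite [ract _ _ _]tens_ractE !yoneda_funE.
    by rewrite hf.1.2 (svalP (fmap G phi)).1.2.
split=> //; apply: tens_ext.
- exact: lin_comp ly (rho_rhom (G M)).1.
- exact: lin_comp (cofree_rhom D (hom_rmod Sg M)).1 (tmap_lin hy (lhom_id D)).
move=> phi d; rewrite yoneda_funE (svalP (fmap G phi)).2 hf.2 /= cofree_rhoE.
rewrite (tmap_comp _ _ _ (svalP (fmap G phi)).1 (lhom_id D)).
move: (cop D d); apply: tens_ext => [||d1 d2].
- exact: tmap_lin (rhom_comp hf.1 (svalP (fmap G phi)).1) (lhom_id D).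
- exact: lin_comp (lin_comp (bal_r (tpure_bal (hom_rmod Sg M) (tens_l D D)) phi)
    (@tassoci_lin _ _ _ _ _ _ (hom_rmod Sg M) D D)) (tmap_lin hy (lhom_id D)).
- rewrite tassociE (tmapE hy (lhom_id D)) yoneda_funE.
  exact: (tmapE (rhom_comp hf.1 (svalP (fmap G phi)).1) (lhom_id D)).
Qed.

Definition yoneda_chom (M : comodule C) : chom (V M) (G M) :=
  exist _ _ (yoneda_colinear M).

Lemma yoneda_natural : natural yoneda_chom.
Proof.
move=> M N g; apply: chom_eq => /=; apply: (tens_ext (r := hom_rmod Sg M) (l := D)).
- exact: lin_comp (tmap_lin (V_map_rhom Sg g) (lhom_id D)) (tsum_lin (yoneda_bal N)).
- exact: lin_comp (tsum_lin (yoneda_bal M)) (svalP (fmap G g)).1.1.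
- move=> phi d; rewrite (tmapE (V_map_rhom Sg g) (lhom_id D)) !yoneda_funE.
  by rewrite fmap_comp.
Qed.

Definition yoneda : Nat V G := exist _ _ yoneda_natural.

End OfElement.

Definition coyoneda (n : Nat V G) (d : D) : G Sg :=
  n $ Sg $ (cid_hom Sg ⊗ d : tens (hom_rmod Sg Sg) D).

Lemma coyoneda_colinear n : colinear (reg_co D) (G Sg) (coyoneda n).
Proof.
exact: colinear_comp (tpure_colinear D (hom_rmod Sg Sg) (cid_hom Sg)) (svalP (n $ Sg)).
Qed.

Lemma coyoneda_fmap n (M : comodule C) (phi : chom Sg M) d :
  fmap G phi $ (coyoneda n d) = n $ M $ (phi ⊗ d : tens (hom_rmod Sg M) D).
Proof.
have /(congr1 (fun h => h $ (cid_hom Sg ⊗ d : tens (hom_rmod Sg Sg) D))) /= <- :=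
  svalP n _ _ phi.
congr (n $ M $ _); rewrite (tmapE (V_map_rhom Sg phi) (lhom_id D)); congr (_ ⊗ _).
exact: chom_eq.
Qed.

Lemma coyoneda_lact n l d :
  coyoneda n (lact D l d) = fmap G (bi_lact Sg l) $ (coyoneda n d).
Proof.
rewrite coyoneda_fmap /coyoneda -(bal_m (tpure_bal (hom_rmod Sg Sg) D)).
by congr (n $ Sg $ (_ ⊗ _)); apply: chom_eq.
Qed.

Lemma yonedaK f hf lf d : coyoneda (@yoneda f hf lf) d = f d.
Proof. by rewrite /coyoneda /= yoneda_funE // fmap_id. Qed.

Lemma coyonedaK n f hf lf : coyoneda n =1 f -> @yoneda f hf lf = n.
Proof.
move=> e; apply: Nat_eq => M; apply: tens_ext.
- exact: (svalP (yoneda hf lf $ M)).1.1.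
- exact: (svalP (n $ M)).1.1.
- by move=> phi d; rewrite /= yoneda_funE // -e coyoneda_fmap.
Qed.

End Yoneda.

(** * The isomorphisms alpha_1 and alpha_3 *)

Section Alpha.
Variables (k : comPzRingType) (A L : kalgebra k) (C : coring A) (D : coring L).
Variables (Sg : bicomodule L C).
Local Notation V := (functorV D Sg).
Local Notation T := (hom_rmod Sg Sg).

Lemma alpha1_colinear (v : homLL D Sg) :
  colinear (reg_co D) (V Sg) (fun d => tmap (sval v) (fun d => d) (cop D d) : tens T D).
Proof. exact: (cofree_of_colinear (N := reg_co D) (bihom_r (svalP v))). Qed.

Lemma alpha1_lact (v : homLL D Sg) l d :
  tmap (sval v) (fun d => d) (cop D (lact D l d)) =
  fmap V (bi_lact Sg l) $ (tmap (sval v) (fun d => d) (cop D d) : tens T D).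
Proof.
have [lv vl vr] := svalP v; have hv : rhom D T (sval v) by [].
have [_ cl _] := cop_bihom D; rewrite cl /= /tens_lact.
rewrite (tmap_comp _ _ _ hv (lhom_id D)).
rewrite (tmap_comp _ _ _ (V_map_rhom Sg (bi_lact Sg l)) (lhom_id D)).
by apply: tmap_ext => // d1; rewrite vl.
Qed.

(** The left L-linear, right D-colinear maps D -> T ⊗ D are the maps
    d |-> v(d1) ⊗ d2 with v an L-bimodule map, since T ⊗ D is cofree; hence the
    transformation phi ⊗ d |-> phi v(d1) ⊗ d2. *)
Definition alpha1_fwd (v : homLL D Sg) : Nat V V :=
  yoneda (G := V) (alpha1_colinear v) (alpha1_lact v).

Lemma alpha1_bwd_subproof (n : Nat V V) :
  bihom D (End_bm Sg) (fun d => ceps (coyoneda n d : tens T D)).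
Proof.
have hc := coyoneda_colinear n; have he := ceps_rhom D T.
have [lh rh] := rhom_comp (r' := tens_r T D) hc.1 he.
split=> // l d; rewrite coyoneda_lact; move: (coyoneda n d); apply: tens_ext.
- exact: lin_comp (tmap_lin (V_map_rhom Sg (bi_lact Sg l)) (lhom_id D)) he.1.
- exact: lin_comp he.1 (lact_linr (End_bm Sg) l).
- move=> t d'; rewrite /= (tmapE (V_map_rhom Sg (bi_lact Sg l)) (lhom_id D)).
  by rewrite !cepsE; apply: chom_eq.
Qed.

Definition alpha1_bwd (n : Nat V V) : homLL D Sg :=
  exist _ _ (alpha1_bwd_subproof n).

Lemma alpha1_apply_bal (M : comodule C) (v : homLL D Sg) :
  balanced (hom_rmod Sg M) D (fun phi d => ccomp phi (v $ d)).
Proof.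
have [lv vl vr] := svalP v; split.
- by move=> d; exact: ccomp_linl.
- by move=> phi; exact: lin_comp lv (ccomp_linr phi).
- by move=> phi l d; rewrite vl; apply: chom_eq.
Qed.

Lemma alpha1_fwdE (v : homLL D Sg) (M : comodule C) (t : tens (hom_rmod Sg M) D) :
  ceps (alpha1_fwd v $ M $ t : tens (hom_rmod Sg M) D) =
  \swe_(phi, d <- t) ccomp phi (v $ d).
Proof.
have [lv vl vr] := svalP v; have hv : rhom D T (sval v) by [].
have b := alpha1_apply_bal M v.
move: t; apply: tens_ext.
- exact: lin_comp (svalP (alpha1_fwd v $ M)).1.1 (ceps_rhom D (hom_rmod Sg M)).1.
- exact: tsum_lin b.
move=> phi d; rewrite (tsumE _ _ b) /=.
rewrite (yoneda_funE (G := V) (alpha1_colinear v) (alpha1_lact v)) /=.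
rewrite (tmap_comp _ _ _ (V_map_rhom Sg phi) (lhom_id D)).
exact: (ceps_cofree_of (N := reg_co D) d (rhom_comp hv (V_map_rhom Sg phi))).
Qed.

Lemma alpha1_bwd_lin : linear alpha1_bwd.
Proof.
by move=> c n n'; apply: funsub_eq => d; exact: ((ceps_rhom D T).1 c).
Qed.

Lemma alpha1_fwdK : cancel alpha1_fwd alpha1_bwd.
Proof.
move=> v; apply: funsub_eq => d /=.
rewrite (yonedaK (G := V) (alpha1_colinear v) (alpha1_lact v)).
exact: (ceps_cofree_of (N := reg_co D) d (bihom_r (svalP v))).
Qed.

Lemma alpha1_bwdK : cancel alpha1_bwd alpha1_fwd.
Proof.
move=> n; apply: coyonedaK => d.
exact: (cofree_colinearE (N := reg_co D) (r := T) d (coyoneda_colinear n)).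
Qed.

Definition alpha1 : kiso (homLL D Sg) (Nat V V) :=
  KIso alpha1_bwd_lin alpha1_fwdK alpha1_bwdK.

Variables (E : coring_ext C D) (pE : pure E).
Local Notation U := (functorU pE).

(** Here U(phi) is phi itself, so that the transformation is
    phi ⊗ d |-> phi(p(d)). *)
Definition alpha3_fwd (p : homLD pE Sg) : Nat V U :=
  yoneda (G := U) (svalP p).2 (svalP p).1.2.

Lemma alpha3_bwd_subproof (n : Nat V U) :
  lhom D (bi_l Sg) (coyoneda n) /\ colinear (reg_co D) (U_obj pE Sg) (coyoneda n).
Proof.
have hc := coyoneda_colinear n; split=> //.
split; [exact: hc.1.1 | move=> l d; exact: (coyoneda_lact n l d)].
Qed.

Definition alpha3_bwd (n : Nat V U) : homLD pE Sg :=
  exist _ _ (alpha3_bwd_subproof n).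

Lemma alpha3_fwdE (p : homLD pE Sg) (M : comodule C) (t : tens (hom_rmod Sg M) D) :
  alpha3_fwd p $ M $ t = \swe_(phi, d <- t) phi $ (p $ d).
Proof. by []. Qed.

Lemma alpha3_bwd_lin : linear alpha3_bwd.
Proof. by move=> c n n'; apply: funsub_eq. Qed.

Lemma alpha3_fwdK : cancel alpha3_fwd alpha3_bwd.
Proof. by move=> p; apply: funsub_eq => d /=; rewrite yonedaK. Qed.

Lemma alpha3_bwdK : cancel alpha3_bwd alpha3_fwd.
Proof. by move=> n; apply: coyonedaK. Qed.

Definition alpha3 : kiso (homLD pE Sg) (Nat V U) :=
  KIso alpha3_bwd_lin alpha3_fwdK alpha3_bwdK.

End Alpha.

(** * The isomorphism alpha_2 *)

Section Beta.
Variables (k : comPzRingType) (A L : kalgebra k) (C : coring A) (D : coring L).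
Variables (E : coring_ext C D) (pE : pure E).
Local Notation U := (functorU pE).
Local Notation EB := (ext_bm E).

Lemma ext_act_reg (c : C) l : ext_act E (reg_co C) c l = ract E c l.
Proof.
have [lc cl cr] := cou_bihom C.
rewrite -[RHS](cou_r C) (ext_cop_r E).2 /= /tens_ract tsum_tmap //.
split.
- by move=> w; exact: ract_linl.
- by move=> v; exact: lin_comp lc (ract_linr C v).
- by move=> v a w; rewrite cl ractA.
Qed.

Lemma reg_ext_rhom : rhom E (ext_rmod E (reg_co C)) (fun c => c).
Proof. by split=> // c l; rewrite /= ext_act_reg. Qed.

Lemma ext_reg_rhom : rhom (ext_rmod E (reg_co C)) E (fun c => c).
Proof. by split=> // c l; rewrite /= ext_act_reg. Qed.

(** On C the functor U gives back the coaction tau_C, but its L-action is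
    c |-> c1 eps(c2 l), which only provably agrees with the given one.  The identity
    map is therefore used as an isomorphism between two comodule structures. *)
Lemma reg_ext_colinear : colinear E (U (coreg C)) (fun c => c).
Proof.
split=> [|c]; first exact: reg_ext_rhom.
apply: (tauJ_inj (pE (coreg C))); rewrite ext_tauE /tauJ.
rewrite (tmap_comp _ _ _ (rho_ext_rhom E (reg_co C)) (lhom_id D)).
exact: esym (ext_cop_col E c).
Qed.

Lemma ext_reg_colinear : colinear (U (coreg C)) E (fun c => c).
Proof.
split=> [|c]; first exact: ext_reg_rhom.
rewrite (reg_ext_colinear.2 c) (tmap_comp _ _ _ ext_reg_rhom (lhom_id D)).
by rewrite tmap_id.
Qed.

Section OfEndomorphism.
Variable u : endCD E.

Lemma endCD_bihom : bihom EB EB (sval u).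
Proof. by have [[[lu au] _] [[_ ru] _]] := svalP u; split. Qed.

Let w := fun c : C => cou C (u $ c).

Lemma endCD_cou_lhom : lhom C (reg_bm A) w.
Proof. exact: lhom_comp (svalP u).1.1 (cou_lhom C). Qed.
Local Notation hw := endCD_cou_lhom.

(** Apply the right counit law to the left C-colinearity of u. *)
Lemma coact_endCD c : coact w (reg_co C) c = u $ c.
Proof.
rewrite -[RHS](rho_counit (reg_co C)) /= (svalP u).1.2 tsum_tmap //.
exact: (coact_bal (reg_co C) (cou_lhom C)).
Qed.

Lemma rho_endCD (M : comodule C) m :
  rho M (coact w M m) = tmap (fun x => x) (sval u) (rho M m).
Proof. by rewrite (rho_coact hw); apply: tmap_ext => // c; exact: coact_endCD. Qed.

Lemma coact_endCD_rhom (M : comodule C) :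
  rhom (ext_rmod E M) (ext_rmod E M) (coact w M).
Proof.
split=> [|m l]; first exact: coact_lin hw.
apply: (rho_inj (M := M)); rewrite rho_endCD.
rewrite (rho_ext_rhom E M).2 (rho_ext_rhom E M).2 rho_endCD.
exact: (tmap_rhom (rhom_id M) endCD_bihom).2.
Qed.

(** Elements of M ⊗_L D are compared after the map m ⊗ d |-> m0 ⊗ m1 ⊗ d, which
    is injective by purity.  There the action of u and the coaction tau both take
    place on the factor C, where they commute because u is right D-colinear. *)
Lemma coact_endCD_colinear (M : comodule C) : colinear (U M) (U M) (coact w M).
Proof.
have hM := rhom_id M; have hD := lhom_id D; have hu := coact_endCD_rhom M.
have he := endCD_bihom; have ht := (svalP u).2.
have hue : lhom (tens_l EB D) (tens_l EB D) (tmap (sval u) (fun d => d)).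
  exact: tmap_lhom he hD.
split=> // m; apply: (tauJ_inj (pE M)); rewrite ext_tauE rho_endCD.
have -> (t : tens (ext_rmod E M) D) :
    tauJ (tmap (coact w M) (fun d => d) t : tens (ext_rmod E M) D) =
    tmap (fun x => x) (tmap (sval u) (fun d => d)) (tauJ t) :> tens M (tens_l EB D).
  move: t; apply: tens_ext.
  - exact: lin_comp (tmap_lin hu hD) (tauJ_lin (lX := D)).
  - exact: lin_comp (tauJ_lin (lX := D)) (tmap_lin hM hue).
  move=> v d; rewrite (tmapE hu hD) !tauJE rho_endCD.
  move: (rho M v); apply: tens_ext.
  - exact: lin_comp (lin_comp (tmap_lin hM (svalP u).1.1)
      (bal_l (tpure_bal (tens_r M EB) D) d)) (@tassoc_lin _ _ _ _ _ _ M EB D).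
  - exact: lin_comp (lin_comp (bal_l (tpure_bal (tens_r M EB) D) d)
      (@tassoc_lin _ _ _ _ _ _ M EB D)) (tmap_lin hM hue).
  - move=> x c; rewrite (tmapE hM (svalP u).1.1) !tassocE (tmapE hM hue).
    by rewrite (tmapE (bihom_r he) hD).
rewrite ext_tauE.
rewrite (tmap_comp _ _ _ hM (bihom_l (rho_ext_bihom E))) (tmap_comp _ _ _ hM hue).
by apply: tmap_ext => // c; exact: ht.2.
Qed.

Definition endCD_chom (M : comodule C) : chom (U M) (U M) :=
  exist _ _ (coact_endCD_colinear M).

Lemma endCD_natural : natural endCD_chom.
Proof.
by move=> M N f; apply: chom_eq => m; rewrite /= -(coact_nat m hw (svalP f)).
Qed.

Definition alpha2_fwd : Nat U U := exist _ _ endCD_natural.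

End OfEndomorphism.

Section OfNat.
Variable n : Nat U U.

Lemma natU_natural (M N : comodule C) (f : M -> N) m : colinear M N f ->
  n $ N $ (f m) = f (n $ M $ m).
Proof.
move=> hf; exact: (congr1 (fun h => h $ m) (svalP n M N (exist _ f hf))).
Qed.

Lemma natU_lin M : linear (sval (n $ M)).
Proof. exact: (svalP (n $ M)).1.1. Qed.

Let th (M : comodule C) (m : M) : M := n $ M $ m.

Lemma alpha2_bwd_subproof :
  lcolinear (sval (n $ (coreg C))) /\ colinear E E (sval (n $ (coreg C))).
Proof.
split; last first.
  apply: colinear_comp ext_reg_colinear.
  exact: colinear_comp reg_ext_colinear (svalP (n $ (coreg C))).
split; first exact: (@natural_lhom _ _ _ th natU_lin natU_natural).
exact: (@rho_natural _ _ _ th natU_lin natU_natural (coreg C)).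
Qed.

(** The member at C: left A-linear and left C-colinear as a member of a natural
    family, right D-colinear as a map U(C) -> U(C). *)
Definition alpha2_bwd : endCD E := exist _ _ alpha2_bwd_subproof.

Lemma natU_coact (M : comodule C) m :
  coact (fun c => cou C (alpha2_bwd $ c)) M m = n $ M $ m.
Proof. exact: esym (@natural_coact _ _ _ th natU_lin natU_natural M m). Qed.

End OfNat.

Lemma alpha2_bwd_lin : linear alpha2_bwd.
Proof. by move=> c n n'; apply: funsub_eq. Qed.

Lemma alpha2_fwdK : cancel alpha2_fwd alpha2_bwd.
Proof. by move=> u; apply: funsub_eq => c; exact: coact_endCD. Qed.

Lemma alpha2_bwdK : cancel alpha2_bwd alpha2_fwd.
Proof. by move=> n; apply: Nat_eq => M m; exact: natU_coact. Qed.

Definition alpha2 : kiso (endCD E) (Nat U U) :=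
  KIso alpha2_bwd_lin alpha2_fwdK alpha2_bwdK.

(** * The isomorphism alpha_4 *)

Variable Sg : bicomodule L C.
Local Notation V := (functorV D Sg).

Section OfQ.
Variable q : Qtilde E Sg.

Let w (x : Sg) (c : C) : A := q $ c $ x.

Lemma Qtilde_lhom x : lhom C (reg_bm A) (w x).
Proof.
have [[lq aq rq] _] := svalP q.
by split=> [b c c'|a c]; rewrite /w ?lq ?aq.
Qed.

Section OneComodule.
Variable M : comodule C.

(** The coaction sends m0 q(m1)(x) to m0 ⊗ m1 q(m2)(x), and the defining condition
    of Q-tilde rewrites the second factor as q(m1)(x0) x1; balancing over A turns
    this into m0 q(m1)(x0) ⊗ x1, as colinearity in x demands. *)
Lemma Qtilde_colinear m : colinear Sg M (fun x => coact (w x) M m).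
Proof.
have [_ cq] := svalP q.
split=> [|x].
  split=> [b x x'|x a]; rewrite /coact.
    rewrite /tsum scaler_sumr -big_split; apply: eq_bigr => p _ /=.
    by rewrite /w (svalP (q $ _)).1 (ract_linr M).
  rewrite (lin_tsum _ _ (ract_linl M a)); apply: tsum_ext => m0 m1.
  by rewrite /w (svalP (q $ _)).2 -ractA.
rewrite (rho_coact (Qtilde_lhom x)).
rewrite (tmap_ext M C (f' := fun m => m) (rho M m) (fun=> erefl) (cq x)).
rewrite /coact; move: (rho Sg x) (rho M m) => y z; rewrite /tmap.
under tsum_ext => m0 m1 do rewrite (lin_tsum _ _ (bal_r (tpure_bal M C) m0)).
under [RHS]tsum_ext => x0 x1 do
  rewrite (lin_tsum _ _ (bal_l (tpure_bal M C) x1)).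
rewrite /tsum exchange_big; apply: eq_bigr => p _; apply: eq_bigr => p' _ /=.
by rewrite (bal_m (tpure_bal M C)).
Qed.

Definition Qtilde_chom m : chom Sg M := exist _ _ (Qtilde_colinear m).

Lemma Qtilde_chom_rhom : rhom (ext_rmod E M) (hom_rmod Sg M) Qtilde_chom.
Proof.
have [[_ _ rq] _] := svalP q.
split=> [b m m'|m l]; apply: chom_eq => x.
  exact: coact_lin (Qtilde_lhom x) b m m'.
rewrite /= {1}/coact rho_ext_act /= /tens_ract tsum_tmap; last first.
  exact: coact_bal (Qtilde_lhom x).
by apply: tsum_ext => m0 m1; rewrite /w rq.
Qed.

(** V(M) is cofree, so the L-linear map m |-> m0 q(m1)(-) induces a colinear map
    U(M) -> V(M). *)
Definition Qtilde_nat : chom (U M) (V M) :=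
  exist _ _ (cofree_of_colinear (N := U M) Qtilde_chom_rhom).

End OneComodule.

Lemma Qtilde_natural : natural Qtilde_nat.
Proof.
move=> M N f; apply: chom_eq => m /=.
have [hf cf] := svalP (fmap U f); have /= -> := cf m.
rewrite (tmap_comp _ _ _ (Qtilde_chom_rhom N) (lhom_id D)).
rewrite (tmap_comp _ _ _ (V_map_rhom Sg f) (lhom_id D)).
apply: (tmap_ext (hom_rmod Sg N) D) => // m'; apply: chom_eq => x.
exact: esym (coact_nat m' (Qtilde_lhom x) (svalP f)).
Qed.

Definition alpha4_fwd : Nat U V := exist _ _ Qtilde_natural.

Lemma alpha4_fwdE (M : comodule C) m :
  ceps (alpha4_fwd $ M $ m : tens (hom_rmod Sg M) D) = Qtilde_chom m.
Proof. exact: (ceps_cofree_of (N := U M) m (Qtilde_chom_rhom M)). Qed.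

End OfQ.

Section OfNatUV.
Variable n : Nat U V.

(** The composite of n with X ⊗ eps, for X = Hom(Sigma, M), determines n.  For
    each x in Sigma the maps m |-> natUV_chom m x form a natural family of
    endomaps, hence are the action of a form on C. *)
Definition natUV_chom (M : comodule C) (m : M) : chom Sg M :=
  ceps (n $ M $ m : tens (hom_rmod Sg M) D).

Lemma natUV_rhom (M : comodule C) :
  rhom (ext_rmod E M) (hom_rmod Sg M) (@natUV_chom M).
Proof. exact: rhom_comp (svalP (n $ M)).1 (ceps_rhom D (hom_rmod Sg M)). Qed.

Lemma ceps_V_map (M N : comodule C) (f : chom M N) (t : tens (hom_rmod Sg M) D) :
  ceps (V_map D Sg f $ t : tens (hom_rmod Sg N) D) = ccomp f (ceps t).
Proof.
have hf := V_map_rhom Sg f.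
rewrite /= /ceps tsum_tmap; last exact: ceps_bal.
rewrite (lin_tsum _ _ hf.1).
by rewrite /tsum; apply: eq_bigr => p _; exact: esym (hf.2 p.1 (cou D p.2)).
Qed.

Let th (x : Sg) (M : comodule C) (m : M) : M := natUV_chom m $ x.

Lemma natUV_lin x (M : comodule C) : linear (@th x M).
Proof. by move=> c m m'; rewrite /th (natUV_rhom M).1. Qed.

Lemma natUV_natural x (M N : comodule C) (f : M -> N) m : colinear M N f ->
  th x (f m) = f (th x m).
Proof.
move=> hf; pose f' : chom M N := exist _ f hf.
have /(congr1 (fun h => h $ m)) /= e := svalP n M N f'.
rewrite /th /natUV_chom e.
by rewrite (ceps_V_map f').
Qed.

Lemma natUV_dual_rhom (c : C) :
  rhom Sg (reg_bm A) (fun x => cou C (natUV_chom (M := coreg C) c $ x)).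
Proof.
exact: rhom_comp (svalP (natUV_chom (M := coreg C) c)).1 (bihom_r (cou_bihom C)).
Qed.

Definition natUV_dual (c : C) : dual Sg := exist _ _ (natUV_dual_rhom c).

(** Both sides of the condition defining Q-tilde are equal to theta(c)(x), where
    theta is the member of [natUV_chom] at C: the left one because theta(-)(x) is
    the action of the form eps(theta(-)(x)), the right one by colinearity of
    theta(c) and the left counit law. *)
Lemma alpha4_bwd_subproof :
  bihom EB (dual_bm Sg) natUV_dual /\
  forall x c, \swe_(c1, c2 <- cop C c) ract C c1 (natUV_dual c2 $ x) =
              \swe_(x0, x1 <- rho Sg x) lact C (natUV_dual c $ x0) x1.
Proof.
have hl x := cou_natural_lhom (natUV_lin x) (@natUV_natural x).
split; first split.
- by move=> b c c'; apply: funsub_eq => x; exact: (hl x).1.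
- by move=> a c; apply: funsub_eq => x; exact: (hl x).2.
- move=> c l; apply: funsub_eq => x /=.
  have := (natUV_rhom (coreg C)).2 c l; rewrite [X in natUV_chom X]ext_act_reg => e.
  exact: (congr1 (fun h : chom Sg (coreg C) => cou C (h $ x)) e).
move=> x c.
apply: (etrans (esym (natural_coact (natUV_lin x) (@natUV_natural x) (M := coreg C) c))).
rewrite /th -[LHS](cou_l C).
have [_ e] := svalP (natUV_chom (M := coreg C) c).
have /= -> := e x; rewrite tsum_tmap //.
have [lc cl cr] := cou_bihom C; split.
- by move=> d; exact: lin_comp lc (lact_linl C d).
- by move=> v; exact: lact_linr.
- by move=> v a d; rewrite cr lactA.
Qed.

Definition alpha4_bwd : Qtilde E Sg := exist _ _ alpha4_bwd_subproof.

Lemma natUV_coact (M : comodule C) (m : M) : Qtilde_chom alpha4_bwd m = natUV_chom m.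
Proof.
apply: chom_eq => x.
exact: esym (natural_coact (natUV_lin x) (@natUV_natural x) m).
Qed.

End OfNatUV.

Lemma alpha4_bwd_lin : linear alpha4_bwd.
Proof.
have [lc _ _] := cou_bihom C.
move=> a n n'; apply: funsub_eq => c; apply: funsub_eq => x /=; rewrite -lc.
congr (cou C _).
by rewrite /natUV_chom /= (ceps_rhom D (hom_rmod Sg (coreg C))).1.
Qed.

Lemma alpha4_fwdK : cancel alpha4_fwd alpha4_bwd.
Proof.
move=> q; apply: funsub_eq => c; apply: funsub_eq => x.
rewrite /= /natUV_chom alpha4_fwdE /=.
exact: cou_coact (Qtilde_lhom q x) c.
Qed.

Lemma alpha4_bwdK : cancel alpha4_bwd alpha4_fwd.
Proof.
move=> n; apply: Nat_eq => M m.
apply: etrans (esym (cofree_colinearE (N := U M) m (svalP (n $ M)))).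
by apply: tmap_ext => // m'; exact: natUV_coact.
Qed.

Definition alpha4 : kiso (Qtilde E Sg) (Nat U V) :=
  KIso alpha4_bwd_lin alpha4_fwdK alpha4_bwdK.

End Beta.

(** * The structure of the transported context *)

Section Formulas.
Variables (k : comPzRingType) (A L : kalgebra k) (C : coring A) (D : coring L).
Variables (E : coring_ext C D) (pE : pure E) (Sg : bicomodule L C).
Local Notation U := (functorU pE).
Local Notation V := (functorV D Sg).
Local Notation T := (hom_rmod Sg Sg).

Lemma alpha1_id (v : homLL D Sg) d :
  alpha1 D Sg v $ Sg $ (cid_hom Sg ⊗ d : tens T D) =
  tmap (sval v) (fun d => d) (cop D d) :> tens T D.
Proof. exact: (yonedaK (G := V) (alpha1_colinear v) (alpha1_lact v)). Qed.

Lemma alpha3_id (p : homLD pE Sg) d :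
  alpha3 Sg pE p $ Sg $ (cid_hom Sg ⊗ d : tens T D) = p $ d.
Proof. exact: (yonedaK (G := U) (svalP p).2 (svalP p).1.2). Qed.

Lemma alpha3_apply_bal (M : comodule C) (p : homLD pE Sg) :
  balanced (hom_rmod Sg M) D (fun phi d => phi $ (p $ d)).
Proof. exact: (yoneda_bal (G := U) (svalP p).2 (svalP p).1.2). Qed.

Lemma tsum_tau_reg (X : lmodType k) (f : C -> D -> X) c : balanced E D f ->
  tsum (ext_tau (pE (coreg C)) c) f = tsum (rho E c) f.
Proof.
move=> bf; rewrite (ext_reg_colinear pE).2.
by rewrite tsum_tmap.
Qed.

Lemma transported_mulR (v v' : homLL D Sg) d :
  bwd (alpha1 D Sg) (nat_comp (alpha1 D Sg v') (alpha1 D Sg v)) $ d =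
  \swe_(d1, d2 <- cop D d) ccomp (v $ d1) (v' $ d2).
Proof.
change (ceps (alpha1_fwd v' $ Sg $
  (alpha1 D Sg v $ Sg $ (cid_hom Sg ⊗ d : tens T D)) : tens T D) =
  \swe_(d1, d2 <- cop D d) ccomp (v $ d1) (v' $ d2)).
rewrite alpha1_id alpha1_fwdE.
rewrite tsum_tmap //; exact: alpha1_apply_bal.
Qed.

Lemma transported_mulS (u u' : endCD E) c :
  bwd (alpha2 pE) (nat_comp (alpha2 pE u') (alpha2 pE u)) $ c = u' $ (u $ c).
Proof. by rewrite /= !coact_endCD. Qed.

Lemma transported_lactP (v : homLL D Sg) (p : homLD pE Sg) d :
  bwd (alpha3 Sg pE) (nat_comp (alpha3 Sg pE p) (alpha1 D Sg v)) $ d =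
  \swe_(d1, d2 <- cop D d) (v $ d1 $ (p $ d2)).
Proof.
change (alpha3_fwd p $ Sg $
  (alpha1 D Sg v $ Sg $ (cid_hom Sg ⊗ d : tens T D)) =
  \swe_(d1, d2 <- cop D d) (v $ d1 $ (p $ d2))).
rewrite alpha1_id alpha3_fwdE.
rewrite tsum_tmap //; exact: (alpha3_apply_bal Sg p).
Qed.

Lemma transported_ractP (p : homLD pE Sg) (u : endCD E) d :
  bwd (alpha3 Sg pE) (nat_comp (alpha2 pE u) (alpha3 Sg pE p)) $ d =
  coact (fun c => cou C (u $ c)) Sg (p $ d).
Proof. by congr (coact _ Sg _); exact: alpha3_id. Qed.

Lemma transported_ractQ (q : Qtilde E Sg) (v : homLL D Sg) c x :
  bwd (alpha4 pE Sg) (nat_comp (alpha1 D Sg v) (alpha4 pE Sg q)) $ c $ x =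
  \swe_(c0, c1 <- rho E c) (q $ c0 $ (v $ c1 $ x)).
Proof.
have [lc _ _] := cou_bihom C.
rewrite /= /natUV_chom [X in ceps X]/= alpha1_fwdE.
rewrite tsum_tmap; last exact: alpha1_apply_bal.
have [[lq aq rq] _] := svalP q; have [lv vl vr] := svalP v.
have b : balanced E D (fun c0 c1 => q $ c0 $ (v $ c1 $ x)).
  split.
  - by move=> d a c0 c0'; rewrite lq.
  - by move=> c0 a d d'; rewrite lv /=; exact: (svalP (q $ c0)).1.
  - by move=> c0 l d; rewrite vl rq.
have ev (M N : comodule C) (y : M) : linear (fun f : chom M N => f $ y) by [].
rewrite (lin_tsum _ _ (ev Sg (coreg C) x)) (lin_tsum _ _ lc) -(tsum_tau_reg c b).
apply: tsum_ext => c0 d /=.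
exact: cou_coact (Qtilde_lhom q _) c0.
Qed.

Lemma transported_lactQ (u : endCD E) (q : Qtilde E Sg) c :
  bwd (alpha4 pE Sg) (nat_comp (alpha4 pE Sg q) (alpha2 pE u)) $ c = q $ (u $ c).
Proof.
apply: funsub_eq => x.
rewrite /= /natUV_chom [X in ceps X]/= alpha4_fwdE /= coact_endCD.
exact: cou_coact (Qtilde_lhom q x) _.
Qed.

(** The common source of the two expressions of q • p: the first is obtained from
    it by the right D-colinearity of the coproduct of C, the second by the
    condition defining Q-tilde. *)
Lemma transported_bul_coact (q : Qtilde E Sg) (p : homLD pE Sg) c :
  bwd (alpha2 pE) (nat_comp (alpha3 Sg pE p) (alpha4 pE Sg q)) $ c =
  \swe_(c0, c1 <- rho E c)
    coact (fun c2 : C => q $ c2 $ (p $ c1)) (reg_co C) c0.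
Proof.
have [[_ lp] [[lp' _] _]] := svalP p.
have hq := Qtilde_chom_rhom q (coreg C).
change (alpha3_fwd p $ (coreg C) $ (alpha4_fwd pE q $ (coreg C) $ c) =
  \swe_(c0, c1 <- rho E c) coact (fun c2 : C => q $ c2 $ (p $ c1)) (reg_co C) c0).
rewrite alpha3_fwdE tsum_tmap; last exact: (alpha3_apply_bal (coreg C) p).
apply: (tsum_tau_reg (f := fun c0 c1 =>
  coact (fun c2 : C => q $ c2 $ (p $ c1)) (reg_co C) c0)).
split.
- by move=> d; exact: coact_lin (Qtilde_lhom q _).
- by move=> c0 a d d'; rewrite lp'; exact: (svalP (Qtilde_chom q (M := coreg C) c0)).1.1.
- move=> c0 l d; rewrite lp -ext_act_reg.
  exact: (congr1 (fun h : chom Sg (coreg C) => h $ (p $ d)) (hq.2 c0 l)).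
Qed.

Lemma transported_bul_cop (q : Qtilde E Sg) (p : homLD pE Sg) c :
  bwd (alpha2 pE) (nat_comp (alpha3 Sg pE p) (alpha4 pE Sg q)) $ c =
  \swe_(c1, c2 <- cop C c) \swe_(c20, c21 <- rho E c2)
     ract C c1 (q $ c20 $ (p $ c21)).
Proof.
have [[lq aq rq] _] := svalP q; have [[_ lp] [[lp' _] _]] := svalP p.
have b : balanced E D (fun c0 d => q $ c0 $ (p $ d)).
  split.
  - by move=> d a c0 c0'; rewrite lq.
  - by move=> c0 a d d'; rewrite lp' (svalP (q $ c0)).1.
  - by move=> c0 l d; rewrite lp rq.
(* Both sides are the image of c1 ⊗ c2_0 ⊗ c2_1 under F, as the coaction of
   C ⊗ C is carried by the second factor. *)
pose F (c1 : C) (y : tens E D) : C :=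
  ract C c1 (\swe_(c20, c21 <- y) (q $ c20 $ (p $ c21))).
have bF : balanced C (tens_l (ext_bm E) D) F.
  split.
  - by move=> y; exact: ract_linl.
  - by move=> c1; exact: lin_comp (tsum_lin b) (ract_linr C c1).
  - move=> c1 a y; rewrite /F ractA; congr (ract C c1 _).
    move: y; apply: tens_ext.
    + exact: lin_comp (tsum_lin b) (kmul_linr A a).
    + exact: lin_comp (lact_linr (tens_l (ext_bm E) D) a) (tsum_lin b).
    + by move=> c0 d; rewrite /= tens_lactE !tsumE // aq.
transitivity (tsum (tmap (fun x => x) (rho E) (cop C c) : tens C (tens_l (ext_bm E) D)) F).
  rewrite -ext_cop_col transported_bul_coact.
  have bG : balanced (tens_r C (ext_bm E)) D (fun y d =>
      \swe_(c1, c2 <- y) ract C c1 (q $ c2 $ (p $ d))).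
    have bd d := coact_bal (reg_co C) (Qtilde_lhom q (p $ d)).
    split.
    - by move=> d; exact: tsum_lin (bd d).
    - move=> y; apply: (tsum_lin2 (F := fun d c1 c2 => ract C c1 (q $ c2 $ (p $ d)))).
      by move=> c1 c2 a d d'; rewrite lp' (svalP (q $ c2)).1 (ract_linr C).
    - move=> y l d; rewrite /= /tens_ract tsum_tmap; last exact: bd.
      by apply: tsum_ext => c1 c2; rewrite lp rq.
  have -> (z : tens (tens_r C (ext_bm E)) D) : tsum (tassoc z : tens C (tens_l (ext_bm E) D)) F =
     \swe_(y, d <- z) \swe_(c1, c2 <- y) ract C c1 (q $ c2 $ (p $ d)).
    move: z; apply: tens_ext_l.
    + exact: lin_comp (@tassoc_lin _ _ _ _ _ _ C (ext_bm E) D) (tsum_lin bF).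
    + exact: tsum_lin bG.
    + move=> c1 c2 d; rewrite tassocE !tsumE //.
        by rewrite /F tsumE.
      exact: (coact_bal (reg_co C) (Qtilde_lhom q _)).
  by rewrite tsum_tmap.
rewrite tsum_tmap //; apply: tsum_ext => c1 c2.
by rewrite /F (lin_tsum _ _ (ract_linr C c1)).
Qed.

Lemma transported_bul_rho (q : Qtilde E Sg) (p : homLD pE Sg) c :
  bwd (alpha2 pE) (nat_comp (alpha3 Sg pE p) (alpha4 pE Sg q)) $ c =
  \swe_(c0, c1 <- rho E c) \swe_(x0, x1 <- rho Sg (p $ c1))
             lact C (q $ c0 $ x0) x1.
Proof.
rewrite transported_bul_coact; apply: tsum_ext => c0 d /=.
exact: (svalP q).2.
Qed.

Lemma transported_loz (p : homLD pE Sg) (q : Qtilde E Sg) d y :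
  bwd (alpha1 D Sg) (nat_comp (alpha4 pE Sg q) (alpha3 Sg pE p)) $ d $ y =
  \swe_(x0, x1 <- rho Sg (p $ d)) ract Sg x0 (q $ x1 $ y).
Proof.
change (ceps (alpha4_fwd pE q $ Sg $
  (alpha3 Sg pE p $ Sg $ (cid_hom Sg ⊗ d : tens T D)) : tens T D) $ y =
  \swe_(x0, x1 <- rho Sg (p $ d)) ract Sg x0 (q $ x1 $ y)).
by rewrite alpha3_id alpha4_fwdE.
Qed.
End Formulas.

Theorem proposition3p1 (k : comPzRingType) (A L : kalgebra k)
    (C : coring A) (D : coring L) (E : coring_ext C D) (pE : pure E)
    (Sg : bicomodule L C) :
  let U := functorU pE in
  let V := functorV D Sg in
  exists M : morita_context (homLL D Sg) (endCD E) (homLD pE Sg) (Qtilde E Sg),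
    (* the algebra structures *)
    ((forall (v v' : homLL D Sg) (d : D),
        kmul (mc_R M) v v' $ d =
        \swe_(d1, d2 <- cop D d) ccomp (v $ d1) (v' $ d2)) /\
     (forall (u u' : endCD E) (c : C),
        kmul (mc_S M) u u' $ c = u' $ (u $ c))) /\
    (* the bimodule structures *)
    [/\ forall (v : homLL D Sg) (p : homLD pE Sg) (d : D),
          lact (mc_P M) v p $ d =
          \swe_(d1, d2 <- cop D d) (v $ d1 $ (p $ d2)),
        forall (p : homLD pE Sg) (u : endCD E) (d : D),
          ract (mc_P M) p u $ d =
          \swe_(x0, x1 <- rho Sg (p $ d)) ract Sg x0 (cou C (u $ x1)),
        forall (q : Qtilde E Sg) (v : homLL D Sg) (c : C) (x : Sg),
          ract (mc_Q M) q v $ c $ x =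
          \swe_(c0, c1 <- rho E c) (q $ c0 $ (v $ c1 $ x))
      & forall (u : endCD E) (q : Qtilde E Sg) (c : C),
          lact (mc_Q M) u q $ c = q $ (u $ c)] /\
    (* the connecting homomorphisms *)
    [/\ forall (q : Qtilde E Sg) (p : homLD pE Sg) (c : C),
          mc_bul M (q ⊗ p) $ c =
          \swe_(c1, c2 <- cop C c) \swe_(c20, c21 <- rho E c2)
             ract C c1 (q $ c20 $ (p $ c21)),
        forall (q : Qtilde E Sg) (p : homLD pE Sg) (c : C),
          mc_bul M (q ⊗ p) $ c =
          \swe_(c0, c1 <- rho E c) \swe_(x0, x1 <- rho Sg (p $ c1))
             lact C (q $ c0 $ x0) x1
      & forall (p : homLD pE Sg) (q : Qtilde E Sg) (d : D) (y : Sg),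
          mc_loz M (p ⊗ q) $ d $ y =
          \swe_(x0, x1 <- rho Sg (p $ d)) ract Sg x0 (q $ x1 $ y)] /\
    (* the isomorphism with the context of natural transformations *)
    exists (alpha1 : homLL D Sg -> Nat V V) (alpha2 : endCD E -> Nat U U)
           (alpha3 : homLD pE Sg -> Nat V U) (alpha4 : Qtilde E Sg -> Nat U V),
      morita_iso M (nat_morita V U) alpha1 alpha2 alpha3 alpha4.
Proof.
move=> U V.
pose M := transport_morita (nat_morita V U)
  (alpha1 D Sg) (alpha2 pE) (alpha3 Sg pE) (alpha4 pE Sg).
have bulE q p : mc_bul M (q ⊗ p) =
    bwd (alpha2 pE) (nat_comp (alpha3 Sg pE p) (alpha4 pE Sg q)).
  by rewrite transport_bulE /= /nat_conn (tsumE _ _ (nat_conn_bal U V)).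
have lozE p q : mc_loz M (p ⊗ q) =
    bwd (alpha1 D Sg) (nat_comp (alpha4 pE Sg q) (alpha3 Sg pE p)).
  by rewrite transport_lozE /= /nat_conn (tsumE _ _ (nat_conn_bal V U)).
exists M; split; [split | split; [split | split; [split |]]].
- exact: transported_mulR.
- exact: transported_mulS.
- exact: transported_lactP.
- exact: transported_ractP.
- exact: transported_ractQ.
- exact: transported_lactQ.
- by move=> q p c; rewrite bulE; exact: transported_bul_cop.
- by move=> q p c; rewrite bulE; exact: transported_bul_rho.
- by move=> p q d y; rewrite lozE; exact: transported_loz.
- exists (alpha1 D Sg), (alpha2 pE), (alpha3 Sg pE), (alpha4 pE Sg).
  exact: transport_morita_iso.
Qed.
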